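(* Let $q>1$ be any real number. Then $$\sum_{n=1}^{\infty}(-1)^{n+1}H_n\left[\frac{1}{qn+q-1}+\frac{1}{qn+1}\right]=\frac{1}{4q}\left(\psi'\left(\frac{2q-1}{2q}\right)-\psi'\left(\frac{q-1}{2q}\right)\right)-\frac{\pi}{q\sin\frac{\pi}{q}}\left(\psi\left(1-\frac{1}{q}\right)-\psi(1)\right).$$
   Context: $H_n=1+\frac12+\cdots+\frac1n$ is the $n$th harmonic number; $\psi=\Gamma'/\Gamma$ is the digamma function and $\psi'$ its derivative. *)

(* Defs.v *)
From Stdlib Require Import Reals.
From Coquelicot Require Import Coquelicot.
Open Scope R_scope.

Definition harmonic (n : nat) : R := sum_n_m (fun k => / INR k) 1 n.

(* Euler's integral of the second kind; it is the Gamma function for 0 < x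
   only (for x <= 0 the integral diverges and RInt_gen is unspecified). *)
Definition Gamma (x : R) : R :=
  RInt_gen (fun t => Rpower t (x - 1) * exp (- t))
    (at_right 0) (Rbar_locally p_infty).

Definition digamma (x : R) : R := Derive Gamma x / Gamma x.

Definition trigamma (x : R) : R := Derive digamma x.

(* Main.v *)
Require Import Defs.
From Stdlib Require Import Reals Lra Lia Arith Classical_Prop.
From Coquelicot Require Import Coquelicot.
Open Scope R_scope.

(** Put [b = 1 - 1/q], [P_N = sum_(n<N) (-1)^n (1/(n+b) + 1/(n+1-b))],
    [U_N = sum_(j<N) 1/(j+b)] and [Q_N = sum_(n<N) (-1)^n/(n+b)^2]. Expanding
    [P_N U_N] in partial fractions in [b] gives
    [P_N U_N = Q_N + sum_(n<N) (-1)^n (1/(n+b) + 1/(n+1-b)) (H_N - H_n) + o(1)],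
    so [q] times the partial sums of the series equal
    [P_N (U_N - H_N) - Q_N + o(1)].
    Here [P_N] tends to [PI / sin (PI b)] (a Dirichlet-kernel argument reducing
    it to Leibniz's series for [PI]), [U_N - H_N] to [digamma 1 - digamma b], and
    [Q_N] to a difference of trigamma values. The last two limits come from
    [Gamma (z + l) <= z^l Gamma z] for [0 <= l <= 1], which with the functional
    equation forces [ln Gamma x = lim (ln Gamma n + x ln n - sum_(k<n) ln (x+k))];
    second-order remainder bounds uniform in [n] allow differentiating this limit
    twice. *)

(** * Finite sums and alternating estimates *)

(** The terms decay only like [ln n / n], so the series converges conditionally and double sums
    cannot be rearranged at infinity. All rearrangement is therefore done at finite [N], with an
    explicit remainder. The pairing of [b] with [1 - b] is what makes this work: [1/((n+b)(j+b))]
    splits over [j - n], and [1/((n+1-b)(j+b))] splits over [n + j + 1], so [b] disappears from the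
    coefficients. Summing the coefficients of the [n]-dependent factor over [j] produces differences
    of harmonic numbers, which is how [H_n] enters; the coefficients of [1/(j+b)] nearly cancel
    between the two expansions. The scaling is [q/(qn+q-1) = 1/(n+b)] and [q/(qn+1) = 1/(n+1-b)]. *)

Fixpoint psum (f : nat -> R) (n : nat) : R :=
  match n with
  | O => 0
  | S m => psum f m + f m
  end.

Lemma psum_0 (f : nat -> R) : psum f 0 = 0.
Proof. easy. Qed.

Lemma psum_S (f : nat -> R) (n : nat) : psum f (S n) = psum f n + f n.
Proof. easy. Qed.

Lemma psum_ext (f g : nat -> R) (n : nat) :
  (forall k, (k < n)%nat -> f k = g k) -> psum f n = psum g n.
Proof.
  induction n as [|n IH]; intros H; simpl; [easy|].
  rewrite IH by (intros; apply H; lia). rewrite H by lia. easy.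
Qed.

Lemma psum_plus (f g : nat -> R) (n : nat) :
  psum (fun k => f k + g k) n = psum f n + psum g n.
Proof. induction n as [|n IH]; simpl; [ring|]. rewrite IH; ring. Qed.

Lemma psum_scal (c : R) (f : nat -> R) (n : nat) :
  psum (fun k => c * f k) n = c * psum f n.
Proof. induction n as [|n IH]; simpl; [ring|]. rewrite IH; ring. Qed.

Lemma psum_minus (f g : nat -> R) (n : nat) :
  psum (fun k => f k - g k) n = psum f n - psum g n.
Proof. induction n as [|n IH]; simpl; [ring|]. rewrite IH; ring. Qed.

Lemma psum_swap (f : nat -> nat -> R) (m n : nat) :
  psum (fun i => psum (fun j => f i j) n) m =
  psum (fun j => psum (fun i => f i j) m) n.
Proof.
  induction m as [|m IH]; simpl.
  - induction n as [|n IHn]; simpl; [easy|]. rewrite <- IHn; ring.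
  - rewrite IH, psum_plus. easy.
Qed.

Lemma psum_shift (f : nat -> R) (n : nat) :
  psum f (S n) = f O + psum (fun k => f (S k)) n.
Proof.
  induction n as [|n IH]; [simpl; ring|].
  change (psum f (S n) + f (S n) =
          f O + (psum (fun k => f (S k)) n + f (S n))).
  rewrite IH; ring.
Qed.

Lemma psum_le (f g : nat -> R) (n : nat) :
  (forall k, (k < n)%nat -> f k <= g k) -> psum f n <= psum g n.
Proof.
  induction n as [|n IH]; intros H; simpl; [lra|].
  apply Rplus_le_compat; [apply IH; intros; apply H; lia | apply H; lia].
Qed.

Lemma psum_Rabs (f g : nat -> R) (n : nat) :
  (forall k, (k < n)%nat -> Rabs (f k) <= g k) -> Rabs (psum f n) <= psum g n.
Proof.
  induction n as [|n IH]; intros H; simpl; [rewrite Rabs_R0; lra|].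
  eapply Rle_trans; [apply Rabs_triang|].
  apply Rplus_le_compat; [apply IH; intros; apply H; lia | apply H; lia].
Qed.

Lemma psum_nonneg (f : nat -> R) (n : nat) :
  (forall k, (k < n)%nat -> 0 <= f k) -> 0 <= psum f n.
Proof.
  induction n as [|n IH]; intros H; simpl; [lra|].
  apply Rplus_le_le_0_compat; [apply IH; intros; apply H; lia | apply H; lia].
Qed.

Lemma psum_cat (f : nat -> R) (m n : nat) :
  psum f (m + n) = psum f m + psum (fun k => f (m + k)%nat) n.
Proof.
  induction n as [|n IH]; simpl.
  - rewrite Nat.add_0_r; ring.
  - rewrite Nat.add_succ_r. simpl. rewrite IH; ring.
Qed.

Lemma psum_single (f : nat -> R) (m n : nat) : (m < n)%nat ->
  psum (fun k => if Nat.eqb m k then f k else 0) n = f m.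
Proof.
  assert (H0 : forall n, (n <= m)%nat ->
      psum (fun k => if Nat.eqb m k then f k else 0) n = 0).
  { induction n0 as [|p IH]; intros Hp; simpl; [easy|].
    rewrite IH by lia. destruct (Nat.eqb_spec m p); [lia|ring]. }
  induction n as [|n IH]; intros Hm; [lia|]. simpl.
  destruct (Nat.eqb_spec m n) as [->|Hne].
  - rewrite H0 by lia; ring.
  - rewrite IH by lia; ring.
Qed.

Lemma is_series_psum (a : nat -> R) (l : R) :
  is_lim_seq (psum a) l -> is_series a l.
Proof.
  (* [sum_n a n] includes the index [n], while [psum a n] stops before it. *)
  intros H. apply is_lim_seq_incr_1 in H.
  change (is_lim_seq (sum_n a) l).
  eapply is_lim_seq_ext; [|exact H]. intros n. simpl.
  induction n as [|n IH].
  - simpl. rewrite sum_O. ring.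
  - rewrite sum_Sn. unfold plus; simpl. rewrite <- IH. easy.
Qed.

(** * Harmonic numbers and their growth *)

Lemma harmonic_psum (n : nat) : harmonic n = psum (fun k => / INR (S k)) n.
Proof.
  unfold harmonic. induction n as [|n IH].
  - rewrite sum_n_m_zero by lia. easy.
  - rewrite sum_n_Sm by lia. rewrite IH. easy.
Qed.

Lemma harmonic_S (n : nat) : harmonic (S n) = harmonic n + / INR (S n).
Proof. rewrite !harmonic_psum. easy. Qed.

Lemma harmonic_0 : harmonic 0 = 0.
Proof. rewrite harmonic_psum. easy. Qed.

Lemma harmonic_add (m n : nat) :
  harmonic (m + n) = harmonic m + psum (fun k => / INR (S (m + k))) n.
Proof. rewrite !harmonic_psum, psum_cat. easy. Qed.

(** A crude bound, enough for [H_n / n -> 0]. With [x^2 = n] and [y^2 = n + 1] one has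
    [(y - x)(y + x) = 1], so [1/y^2 <= 1/y <= 2 (y - x)], and the right side telescopes. *)
Lemma harmonic_le_sqrt (n : nat) : harmonic n <= 2 * sqrt (INR n).
Proof.
  induction n as [|n IH].
  - rewrite harmonic_0. simpl. rewrite sqrt_0. lra.
  - rewrite harmonic_S.
    set (x := sqrt (INR n)) in *. set (y := sqrt (INR (S n))).
    assert (Hx : x * x = INR n) by (apply sqrt_sqrt, pos_INR).
    assert (Hy : y * y = INR n + 1)
      by (unfold y; rewrite sqrt_sqrt by apply pos_INR; apply S_INR).
    assert (Hx0 : 0 <= x) by apply sqrt_pos.
    assert (Hn : 0 <= INR n) by apply pos_INR.
    assert (Hy1 : 1 <= y).
    { unfold y. rewrite <- sqrt_1. apply sqrt_le_1_alt. rewrite S_INR; lra. }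
    rewrite S_INR, <- Hy.
    assert (/ (y * y) <= / y).
    { apply Rinv_le_contravar; nra. }
    assert (/ y <= 2 * (y - x)).
    { assert (/ y * y = 1) by (field; lra).
      assert (0 < / y) by (apply Rinv_0_lt_compat; lra).
      assert (/ y * ((y - x) * (y + x)) = / y) by (replace ((y-x)*(y+x)) with 1 by nra; ring).
      assert (x <= y) by nra. nra. }
    lra.
Qed.

Lemma is_lim_seq_inv_sqrt : is_lim_seq (fun n => / sqrt (INR n)) 0.
Proof.
  apply (is_lim_seq_inv _ p_infty); [|easy].
  apply (filterlim_comp _ _ _ INR sqrt _ (Rbar_locally p_infty) _).
  - apply is_lim_seq_INR.
  - apply filterlim_sqrt_p.
Qed.

Lemma is_lim_seq_harmonic_div : is_lim_seq (fun n => harmonic n / INR n) 0.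
Proof.
  apply is_lim_seq_le_le_loc with (u := fun _ => 0) (w := fun n => 2 * / sqrt (INR n)).
  - exists 1%nat. intros n Hn.
    assert (H1 : 1 <= INR n) by (apply (le_INR 1); lia).
    assert (Hs : 0 < sqrt (INR n)) by (apply sqrt_lt_R0; lra).
    split.
    + apply Rdiv_le_0_compat; [|lra]. rewrite harmonic_psum.
      apply psum_nonneg; intros k _. left. apply Rinv_0_lt_compat, lt_0_INR; lia.
    + apply Rle_trans with (2 * sqrt (INR n) / INR n).
      * apply Rmult_le_compat_r; [left; apply Rinv_0_lt_compat; lra|].
        apply harmonic_le_sqrt.
      * rewrite <- (sqrt_sqrt (INR n)) at 2 by lra. right. field. lra.
  - apply is_lim_seq_const.
  - replace (Finite 0) with (Rbar_mult 2 0) by (simpl; f_equal; ring).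
    apply is_lim_seq_scal_l, is_lim_seq_inv_sqrt.
Qed.

Lemma psum_inv_le_harmonic (b : R) (n : nat) : 0 < b ->
  0 <= psum (fun k => / (INR k + b)) n <= / b + harmonic n.
Proof.
  intros Hb. assert (Hp : forall k, 0 < / (INR k + b)).
  { intros k. apply Rinv_0_lt_compat. pose proof (pos_INR k); lra. }
  split. { apply psum_nonneg; intros k _; left; apply Hp. }
  destruct n as [|n].
  - rewrite harmonic_0. simpl. assert (0 < / b) by (apply Rinv_0_lt_compat; lra). lra.
  - rewrite psum_shift. simpl INR at 1. rewrite Rplus_0_l.
    apply Rplus_le_compat_l.
    apply Rle_trans with (harmonic n).
    + rewrite harmonic_psum. apply psum_le; intros k _.
      apply Rinv_le_contravar; [apply lt_0_INR; lia | lra].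
    + rewrite harmonic_S.
      assert (0 < / INR (S n)) by (apply Rinv_0_lt_compat, lt_0_INR; lia). lra.
Qed.

(** Peeling off the first term leaves [w 0] minus the same sum for the shifted sequence, which by
    induction lies between [0] and [w 1 <= w 0]. *)
Lemma alternating_bounds (w : nat -> R) (n : nat) :
  (forall k, 0 <= w k) -> (forall k, w (S k) <= w k) ->
  0 <= psum (fun k => (-1) ^ k * w k) n <= w O.
Proof.
  revert w. induction n as [|n IH]; intros w H0 H1.
  - simpl. pose proof (H0 O). lra.
  - rewrite psum_shift.
    rewrite (psum_ext _ (fun k => (-1) * ((-1) ^ k * w (S k)))) by (intros; simpl; ring).
    rewrite psum_scal.
    destruct (IH (fun k => w (S k))) as [Ha Hb]; [easy|intros; apply H1|].
    pose proof (H1 O). simpl pow at 1 3. lra.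
Qed.

(* Exchanging the two summations leaves alternating tails, each bounded by its
   first term. *)
Lemma alternating_abel (w d : nat -> R) (n : nat) :
  (forall k, 0 <= w k) -> (forall k, w (S k) <= w k) ->
  (forall k, (k < n)%nat -> 0 <= d k) ->
  Rabs (psum (fun k => (-1) ^ k * w k * psum d (S k)) n)
    <= psum (fun k => d k * w k) n.
Proof.
  revert w d. induction n as [|n IH]; intros w d H0 H1 Hd.
  - simpl. rewrite Rabs_R0; lra.
  - assert (E : psum (fun k => (-1) ^ k * w k * psum d (S k)) (S n) =
      d O * psum (fun k => (-1) ^ k * w k) (S n)
      - psum (fun k => (-1) ^ k * w (S k) * psum (fun i => d (S i)) (S k)) n).
    { rewrite <- psum_scal, !psum_shift.
      rewrite (psum_ext _ (fun k => d O * ((-1) ^ (S k) * w (S k))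
         - (-1) ^ k * w (S k) * psum (fun i => d (S i)) (S k)) n).
      - rewrite psum_minus. change (psum (fun k => d (S k)) 0) with 0. ring.
      - intros k _. rewrite (psum_shift d (S k)), <- tech_pow_Rmult. ring. }
    rewrite E, (psum_shift (fun k => d k * w k)).
    pose proof (IH (fun k => w (S k)) (fun k => d (S k)) (fun k => H0 _)
      (fun k => H1 _) (fun k Hk => Hd (S k) ltac:(lia))) as HI.
    pose proof (alternating_bounds w (S n) H0 H1) as HA.
    pose proof (Hd O ltac:(lia)).
    eapply Rle_trans; [apply Rabs_triang|]. rewrite Rabs_Ropp.
    apply Rplus_le_compat; [|exact HI].
    rewrite Rabs_right by nra. nra.
Qed.

(* The diagonal term [j = n] contributes [/ 0 = 0]. *)
Lemma psum_inv_sub (n m : nat) :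
  psum (fun j => / (INR j - INR n)) (n + 1 + m) = harmonic m - harmonic n.
Proof.
  induction n as [|n IH].
  - rewrite harmonic_0. change (0 + 1 + m)%nat with (S m).
    rewrite psum_shift. simpl INR at 1 2 4. rewrite Rminus_0_r, Rinv_0, harmonic_psum.
    rewrite (psum_ext _ (fun k => / INR (S k))); [ring|].
    intros k _. rewrite Rminus_0_r. easy.
  - change (S n + 1 + m)%nat with (S (n + 1 + m)).
    rewrite psum_shift, harmonic_S.
    rewrite (psum_ext _ (fun j => / (INR j - INR n))).
    + rewrite IH. pose proof (lt_0_INR (S n) ltac:(lia)). change (INR 0) with 0.
      field. lra.
    + intros k _. rewrite !S_INR. f_equal. ring.
Qed.

(* The coefficient of [1/(j+b)] in the expansion of [P_N U_N]. Up to sign it is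
   the alternating block [sum_(N-j <= k <= N+j) (-1)^k/k], hence small. *)
Definition cross_coeff (N j : nat) : R :=
  psum (fun i => (-1) ^ i * / INR (i + j + 1)) N
  - psum (fun n => (-1) ^ n * / (INR j - INR n)) N.

(** Induction on [j] with [m = N - 1 - j] fixed, so that [N] grows along with [j]. Each step flips
    the sign of both sums and adds the same [1/(j+1)] to each, which cancels; the two boundary terms
    left over extend the block at its upper end. *)
Lemma cross_coeff_block (m j : nat) :
  cross_coeff (j + 1 + m) j =
  - (-1) ^ j * psum (fun k => (-1) ^ (m + 1 + k) * / INR (m + 1 + k)) (2 * j + 1).
Proof.
  unfold cross_coeff. induction j as [|j IH].
  - change (0 + 1 + m)%nat with (S m).
    rewrite (psum_shift (fun n => (-1) ^ n * / (INR 0 - INR n))).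
    simpl INR at 2 3 4. rewrite Rminus_0_r, Rinv_0.
    rewrite (psum_ext (fun k => (-1) ^ (S k) * / (0 - INR (S k)))
       (fun i => (-1) ^ i * / INR (i + 0 + 1))).
    + change (2 * 0 + 1)%nat with 1%nat. simpl psum.
      rewrite !Nat.add_0_r. rewrite pow_add.
      pose proof (lt_0_INR (m + 1) ltac:(lia)). field. lra.
    + intros k _. replace (k + 0 + 1)%nat with (S k) by lia.
      pose proof (lt_0_INR (S k) ltac:(lia)). simpl pow. field. lra.
  - set (N := (j + 1 + m)%nat) in *.
    change (S j + 1 + m)%nat with (S N).
    assert (E1 : psum (fun i => (-1) ^ i * / INR (i + S j + 1)) (S N) =
       / INR (j + 1) - psum (fun i => (-1) ^ i * / INR (i + j + 1)) N
       - (-1) ^ N * / INR (N + j + 1) + (-1) ^ N * / INR (N + j + 2)).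
    { clearbody N. clear IH. induction N as [|N IHN].
      - rewrite psum_S, !psum_0. replace (0 + S j + 1)%nat with (0 + j + 2)%nat by lia.
        replace (0 + j + 1)%nat with (j + 1)%nat by lia. simpl pow. ring.
      - change (psum (fun i => (-1) ^ i * / INR (i + S j + 1)) (S (S N))) with
         (psum (fun i => (-1) ^ i * / INR (i + S j + 1)) (S N)
           + (-1) ^ (S N) * / INR (S N + S j + 1)).
        rewrite IHN, (psum_S _ N).
        replace (S N + S j + 1)%nat with (S N + j + 2)%nat by lia.
        replace (N + j + 2)%nat with (S N + j + 1)%nat by lia. simpl pow. ring. }
    assert (E2 : psum (fun n => (-1) ^ n * / (INR (S j) - INR n)) (S N) =
       / INR (j + 1) - psum (fun n => (-1) ^ n * / (INR j - INR n)) N).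
    { rewrite psum_shift. simpl INR at 2. rewrite Rminus_0_r.
      replace (j + 1)%nat with (S j) by lia.
      rewrite (psum_ext _ (fun n => (-1) * ((-1) ^ n * / (INR j - INR n)))).
      - rewrite psum_scal. simpl pow. ring.
      - intros k _. rewrite !S_INR.
        replace (INR j + 1 - (INR k + 1)) with (INR j - INR k) by ring.
        simpl pow. ring. }
    rewrite E1, E2.
    replace (2 * S j + 1)%nat with (S (S (2 * j + 1))) by lia.
    set (f := fun k => (-1) ^ (m + 1 + k) * / INR (m + 1 + k)) in IH |- *.
    change (psum f (S (S (2 * j + 1)))) with
      (psum f (2 * j + 1) + f (2 * j + 1)%nat + f (S (2 * j + 1))).
    assert (Ef : f (2 * j + 1)%nat = (-1) ^ m * / INR (N + j + 1)).
    { unfold f, N. replace (m + 1 + (2 * j + 1))%nat with (j + 1 + m + j + 1)%nat by lia.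
      f_equal. replace (j + 1 + m + j + 1)%nat with (m + 2 * (j + 1))%nat by lia.
      rewrite pow_add, pow_mult. replace ((-1) ^ 2) with 1 by ring.
      rewrite pow1. ring. }
    assert (Eg : f (S (2 * j + 1)) = - (-1) ^ m * / INR (N + j + 2)).
    { unfold f, N. replace (m + 1 + S (2 * j + 1))%nat with (j + 1 + m + j + 2)%nat by lia.
      f_equal. replace (j + 1 + m + j + 2)%nat with (m + (1 + 2 * (j + 1)))%nat by lia.
      rewrite pow_add, (pow_add _ 1), pow_mult. replace ((-1) ^ 2) with 1 by ring.
      rewrite pow1. ring. }
    rewrite Ef, Eg.
    assert (HN : (-1) ^ N = - (-1) ^ j * (-1) ^ m).
    { unfold N. rewrite !pow_add. ring. }
    rewrite HN.
    assert (Hs : (-1) ^ j * (-1) ^ j = 1).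
    { rewrite <- pow_add. replace (j + j)%nat with (2 * j)%nat by lia.
      rewrite pow_mult. replace ((-1) ^ 2) with 1 by ring. apply pow1. }
    set (A := psum _ N) in IH |- *. set (B := psum (fun n => _ * / _) N) in IH |- *.
    assert (HF : psum f (2 * j + 1) = - (-1) ^ j * (A - B)).
    { rewrite IH. transitivity ((-1) ^ j * (-1) ^ j * psum f (2 * j + 1)); [|ring].
      rewrite Hs; ring. }
    rewrite HF, <- (tech_pow_Rmult (-1) j).
    apply Rminus_diag_uniq.
    match goal with |- ?x = 0 =>
      replace x with (((-1) ^ j * (-1) ^ j - 1) * (A - B)) by ring end.
    rewrite Hs; ring.
Qed.

Lemma pow_m1_Rabs (n : nat) : Rabs ((-1) ^ n) = 1.
Proof. rewrite <- RPow_abs, Rabs_m1. apply pow1. Qed.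

(** The block alternates and decreases in size from its first term [1/(N-j)], which bounds it. *)
Lemma cross_coeff_le (N j : nat) : (j < N)%nat ->
  Rabs (cross_coeff N j) <= / (INR N - INR j).
Proof.
  intros Hj. replace N with (j + 1 + (N - 1 - j))%nat by lia.
  set (m := (N - 1 - j)%nat). rewrite cross_coeff_block.
  rewrite Rabs_mult, Rabs_Ropp, pow_m1_Rabs, Rmult_1_l.
  rewrite (psum_ext _ (fun k => (-1) ^ (m + 1) * ((-1) ^ k * / INR (m + 1 + k)))).
  - rewrite psum_scal, Rabs_mult, pow_m1_Rabs, Rmult_1_l.
    destruct (alternating_bounds (fun k => / INR (m + 1 + k)) (2 * j + 1)) as [Ha Hb].
    + intros k. left. apply Rinv_0_lt_compat, lt_0_INR. lia.
    + intros k. apply Rinv_le_contravar; [apply lt_0_INR; lia | apply le_INR; lia].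
    + rewrite Rabs_right by lra.
      replace (INR (j + 1 + m) - INR j) with (INR (m + 1 + 0)); [exact Hb|].
      rewrite !plus_INR. simpl. ring.
  - intros k _. rewrite (pow_add _ (m + 1)). ring.
Qed.

(** * The finite partial-fraction identity *)

(** For [n <> j], [1/((n+b)(j+b)) = (1/(n+b) - 1/(j+b)) / (j-n)]. On the diagonal the convention
    [/ 0 = 0] removes this expression, and the square is supplied by the indicator term. *)
Lemma psum_product_diagonal (b : R) (N : nat) : 0 < b ->
  psum (fun n => (-1) ^ n / (INR n + b)) N * psum (fun j => / (INR j + b)) N =
  psum (fun n => (-1) ^ n / (INR n + b) ^ 2) N
  + psum (fun n => (-1) ^ n / (INR n + b) *
                   (harmonic (N - 1 - n) - harmonic n)) N
  - psum (fun j => / (INR j + b) *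
                   psum (fun n => (-1) ^ n * / (INR j - INR n)) N) N.
Proof.
  intros Hb.
  assert (Hp : forall k, 0 < INR k + b) by (intros k; pose proof (pos_INR k); lra).
  assert (E1 : psum (fun n => (-1) ^ n / (INR n + b)) N
                 * psum (fun j => / (INR j + b)) N =
    psum (fun n => psum (fun j =>
      (if Nat.eqb n j then (-1) ^ j / (INR j + b) ^ 2 else 0)
      + ((-1) ^ n / (INR n + b) * / (INR j - INR n)
         - / (INR j + b) * ((-1) ^ n * / (INR j - INR n)))) N) N).
  { rewrite Rmult_comm, <- psum_scal. apply psum_ext; intros n Hn.
    rewrite Rmult_comm, <- psum_scal. apply psum_ext; intros j Hj.
    pose proof (Hp n); pose proof (Hp j).
    destruct (Nat.eqb_spec n j) as [->|Hne].
    - rewrite Rminus_diag, Rinv_0. field. lra.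
    - assert (INR j - INR n <> 0).
      { intros E. apply Hne. apply INR_eq. lra. }
      field. lra. }
  rewrite E1.
  rewrite (psum_ext _ (fun n => (-1) ^ n / (INR n + b) ^ 2
    + ((-1) ^ n / (INR n + b) * (harmonic (N - 1 - n) - harmonic n)
       - psum (fun j => / (INR j + b) * ((-1) ^ n * / (INR j - INR n))) N))).
  - rewrite psum_plus, psum_minus, psum_swap.
    rewrite (psum_ext _ _ N (fun j _ => psum_scal (/ (INR j + b)) _ N)). ring.
  - intros n Hn. rewrite psum_plus, psum_minus, psum_single by easy.
    rewrite psum_scal. do 3 f_equal.
    rewrite <- psum_inv_sub. f_equal. lia.
Qed.

(** Since [(n+1-b) + (j+b) = n+j+1], one has [1/((n+1-b)(j+b)) = (1/(n+1-b) + 1/(j+b)) / (n+j+1)];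
    there is no exceptional diagonal. *)
Lemma psum_product_reflected (b : R) (N : nat) : 0 < b < 1 ->
  psum (fun n => (-1) ^ n / (INR n + 1 - b)) N * psum (fun j => / (INR j + b)) N =
  psum (fun n => (-1) ^ n / (INR n + 1 - b) *
                 (harmonic (N + n) - harmonic n)) N
  + psum (fun j => / (INR j + b) *
                   psum (fun i => (-1) ^ i * / INR (i + j + 1)) N) N.
Proof.
  intros Hb.
  rewrite Rmult_comm, <- psum_scal.
  rewrite (psum_ext _ (fun n =>
    (-1) ^ n / (INR n + 1 - b) * (harmonic (N + n) - harmonic n)
    + psum (fun j => / (INR j + b) * ((-1) ^ n * / INR (n + j + 1))) N)).
  - rewrite psum_plus, psum_swap.
    rewrite (psum_ext _ _ N (fun j _ => psum_scal (/ (INR j + b)) _ N)). ring.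
  - intros n _.
    replace (harmonic (N + n) - harmonic n) with
      (psum (fun k => / INR (S (n + k))) N).
    + rewrite Rmult_comm, <- !psum_scal, <- psum_plus.
      apply psum_ext; intros j _.
      replace (n + j + 1)%nat with (S (n + j)) by lia.
      rewrite S_INR, plus_INR.
      pose proof (pos_INR n); pose proof (pos_INR j). field. lra.
    + rewrite (Nat.add_comm N n), harmonic_add. ring.
Qed.

(** The error of replacing both [harmonic (N - 1 - n)] and [harmonic (N + n)] by [harmonic N], plus
    the cross terms. *)
Definition pf_remainder (b : R) (N : nat) : R :=
  psum (fun n => (-1) ^ n / (INR n + b) * (harmonic (N - 1 - n) - harmonic N)) N
  + psum (fun n => (-1) ^ n / (INR n + 1 - b) * (harmonic (N + n) - harmonic N)) N
  + psum (fun j => / (INR j + b) * cross_coeff N j) N.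

Lemma psum_product (b : R) (N : nat) : 0 < b < 1 ->
  psum (fun n => (-1) ^ n * (/ (INR n + b) + / (INR n + 1 - b))) N
    * psum (fun j => / (INR j + b)) N =
  psum (fun n => (-1) ^ n / (INR n + b) ^ 2) N
  + psum (fun n => (-1) ^ n * (/ (INR n + b) + / (INR n + 1 - b))
                   * (harmonic N - harmonic n)) N
  + pf_remainder b N.
Proof.
  intros Hb.
  rewrite (psum_ext (fun n => (-1) ^ n * (/ (INR n + b) + / (INR n + 1 - b)))
     (fun n => (-1) ^ n / (INR n + b) + (-1) ^ n / (INR n + 1 - b))).
  2:{ intros; unfold Rdiv; ring. }
  rewrite psum_plus, Rmult_plus_distr_r, psum_product_diagonal by lra.
  rewrite psum_product_reflected by lra. unfold pf_remainder.
  set (Q := psum (fun n => _ / _ ^ 2) N).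
  transitivity (Q +
    (psum (fun n => (-1) ^ n / (INR n + b) * (harmonic (N - 1 - n) - harmonic n)) N
     + psum (fun n => (-1) ^ n / (INR n + 1 - b) * (harmonic (N + n) - harmonic n)) N)
    + psum (fun j => / (INR j + b) * cross_coeff N j) N).
  - rewrite (psum_ext (fun j => / (INR j + b) * cross_coeff N j) (fun j =>
      / (INR j + b) * psum (fun i => (-1) ^ i * / INR (i + j + 1)) N
      - / (INR j + b) * psum (fun n => (-1) ^ n * / (INR j - INR n)) N)).
    + rewrite psum_minus. ring.
    + intros j _. unfold cross_coeff. ring.
  - rewrite !Rplus_assoc. f_equal. rewrite <- !Rplus_assoc. f_equal.
    rewrite <- !psum_plus. apply psum_ext; intros n _. unfold Rdiv; ring.
Qed.

(** * Decay of the remainder *)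

(** Puts the harmonic difference in the form [psum d (S n)] with [d] nonnegative, as
    [alternating_abel] requires. *)
Lemma harmonic_sub (N n : nat) : (n < N)%nat ->
  harmonic N - harmonic (N - 1 - n) = psum (fun k => / (INR N - INR k)) (S n).
Proof.
  induction n as [|n IH]; intros Hn.
  - rewrite psum_S, psum_0. destruct N as [|N]; [lia|].
    replace (S N - 1 - 0)%nat with N by lia. rewrite harmonic_S. simpl (INR 0).
    rewrite Rminus_0_r. ring.
  - rewrite psum_S, <- IH by lia.
    replace (N - 1 - n)%nat with (S (N - 1 - S n)) by lia.
    rewrite harmonic_S, <- minus_INR by lia.
    replace (S (N - 1 - S n)) with (N - S n)%nat by lia. ring.
Qed.

(** Partial fractions once more: [(N-k) + (k+b) = N+b]. The factor [1/(N+b)] against two sums of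
    logarithmic size gives the decay. *)
Lemma psum_inv_prod (b : R) (N : nat) : 0 < b ->
  psum (fun k => / (INR N - INR k) * / (INR k + b)) N =
  / (INR N + b) * (harmonic N + psum (fun k => / (INR k + b)) N).
Proof.
  intros Hb. destruct N as [|N].
  - rewrite !psum_0, harmonic_0. ring.
  - assert (E := harmonic_sub (S N) N ltac:(lia)).
    replace (S N - 1 - N)%nat with 0%nat in E by lia.
    rewrite harmonic_0, Rminus_0_r in E. rewrite E, <- psum_plus, <- psum_scal.
    apply psum_ext; intros k Hk.
    apply lt_INR in Hk. pose proof (pos_INR k). field. lra.
Qed.

(** Termwise absolute values would leave the first two sums bounded but not small, so their signs
    are exploited through [alternating_abel]. In the third the cancellation already sits inside
    [cross_coeff]. The first and third sums share one bound, hence the factor 2. *)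
Lemma Rabs_pf_remainder_le (b : R) (N : nat) : 0 < b < 1 ->
  Rabs (pf_remainder b N) <=
  2 * (/ (INR N + b) * (harmonic N + psum (fun k => / (INR k + b)) N))
  + / INR N * psum (fun k => / (INR k + (1 - b))) N.
Proof.
  intros Hb. unfold pf_remainder.
  assert (Hw : forall c, 0 < c -> (forall k, 0 <= / (INR k + c)) /\
             (forall k, / (INR (S k) + c) <= / (INR k + c))).
  { intros c Hc. split; intros k; pose proof (pos_INR k).
    - left; apply Rinv_0_lt_compat; lra.
    - apply Rinv_le_contravar; [lra|]. rewrite S_INR; lra. }
  rewrite <- psum_inv_prod by lra.
  eapply Rle_trans; [apply Rabs_triang|].
  eapply Rle_trans; [apply Rplus_le_compat_r, Rabs_triang|].
  assert (A1 : Rabs (psum (fun n => (-1) ^ n / (INR n + b) *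
       (harmonic (N - 1 - n) - harmonic N)) N)
       <= psum (fun k => / (INR N - INR k) * / (INR k + b)) N).
  { rewrite (psum_ext _ (fun n => -1 * ((-1) ^ n * / (INR n + b) *
        psum (fun k => / (INR N - INR k)) (S n)))).
    - rewrite psum_scal, Rabs_mult, Rabs_m1, Rmult_1_l.
      apply (alternating_abel (fun k => / (INR k + b))).
      + apply Hw; lra.
      + apply Hw; lra.
      + intros k Hk. apply lt_INR in Hk. left; apply Rinv_0_lt_compat; lra.
    - intros n Hn. rewrite <- harmonic_sub by easy. unfold Rdiv; ring. }
  assert (A3 : Rabs (psum (fun j => / (INR j + b) * cross_coeff N j) N)
       <= psum (fun k => / (INR N - INR k) * / (INR k + b)) N).
  { apply psum_Rabs. intros j Hj. pose proof (pos_INR j).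
    assert (0 < / (INR j + b)) by (apply Rinv_0_lt_compat; lra).
    rewrite Rabs_mult, Rabs_right, Rmult_comm by lra.
    apply Rmult_le_compat_r; [lra|]. apply cross_coeff_le; easy. }
  assert (A2 : Rabs (psum (fun n => (-1) ^ n / (INR n + 1 - b) *
       (harmonic (N + n) - harmonic N)) N)
       <= / INR N * psum (fun k => / (INR k + (1 - b))) N).
  { destruct N as [|N]; [rewrite !psum_0, Rabs_R0; lra|].
    set (M := S N).
    assert (HM : 0 < INR M) by (apply lt_0_INR; unfold M; lia).
    (* [psum d (S n)] has [n + 1] terms but [harmonic (M + n) - harmonic M] only [n]; the initial
       zero makes up the difference. *)
    set (d := fun k => match k with O => 0 | S _ => / INR (M + k) end).
    assert (Hd : forall k, 0 <= d k <= / INR M).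
    { intros [|k]; unfold d.
      - pose proof (Rinv_0_lt_compat _ HM); lra.
      - split; [left; apply Rinv_0_lt_compat, lt_0_INR; lia|].
        apply Rinv_le_contravar; [easy | apply le_INR; lia]. }
    rewrite (psum_ext _ (fun n => (-1) ^ n * / (INR n + (1 - b)) * psum d (S n))).
    - eapply Rle_trans.
      + apply (alternating_abel (fun k => / (INR k + (1 - b)))).
        * apply Hw; lra.
        * apply Hw; lra.
        * intros k _; apply Hd.
      + rewrite <- psum_scal. apply psum_le; intros k _.
        apply Rmult_le_compat_r; [apply Hw; lra | apply Hd].
    - intros n _. rewrite harmonic_add, psum_shift. unfold d at 1.
      rewrite (psum_ext (fun k => d (S k)) (fun k => / INR (S (M + k)))).
      + replace (INR n + 1 - b) with (INR n + (1 - b)) by ring. unfold Rdiv; ring.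
      + intros k _. unfold d. rewrite Nat.add_succ_r. easy. }
  lra.
Qed.

Lemma is_lim_seq_pf_remainder (b : R) : 0 < b < 1 -> is_lim_seq (pf_remainder b) 0.
Proof.
  intros Hb. apply is_lim_seq_abs_0.
  (* Each sum of reciprocals is at most a constant plus [harmonic N]; the harmonic terms number
     [2 * 2 + 1 = 5]. *)
  apply is_lim_seq_le_le_loc with (u := fun _ => 0) (w := fun N =>
    (2 * / b + / (1 - b)) * / INR N + 5 * (harmonic N / INR N)).
  - exists 1%nat. intros N HN. split; [apply Rabs_pos|].
    eapply Rle_trans; [apply Rabs_pf_remainder_le; easy|].
    assert (H1 : 1 <= INR N) by (apply (le_INR 1); lia).
    pose proof (psum_inv_le_harmonic b N ltac:(lra)).
    pose proof (psum_inv_le_harmonic (1 - b) N ltac:(lra)).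
    assert (Hh : 0 <= harmonic N).
    { rewrite harmonic_psum. apply psum_nonneg; intros k _.
      left; apply Rinv_0_lt_compat, lt_0_INR; lia. }
    assert (HI : 0 < / INR N) by (apply Rinv_0_lt_compat; lra).
    assert (HJ : / (INR N + b) <= / INR N) by (apply Rinv_le_contravar; lra).
    unfold Rdiv.
    apply Rle_trans with (2 * (/ INR N * (harmonic N + (/ b + harmonic N)))
      + / INR N * (/ (1 - b) + harmonic N)); [|lra].
    apply Rplus_le_compat.
    + apply Rmult_le_compat_l; [lra|]. apply Rmult_le_compat; try lra.
      left; apply Rinv_0_lt_compat; lra.
    + apply Rmult_le_compat_l; lra.
  - apply is_lim_seq_const.
  - replace 0 with ((2 * / b + / (1 - b)) * 0 + 5 * 0) by ring.
    apply is_lim_seq_plus'.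
    + apply (is_lim_seq_scal_l _ _ 0).
      apply (is_lim_seq_inv _ p_infty); [apply is_lim_seq_INR | easy].
    + apply (is_lim_seq_scal_l _ _ 0), is_lim_seq_harmonic_div.
Qed.

(** * Partial fractions of the cosecant *)

Lemma is_derive_psum (f : nat -> R -> R) (d : nat -> R) (x : R) (n : nat) :
  (forall k, (k < n)%nat -> is_derive (f k) x (d k)) ->
  is_derive (fun y => psum (fun k => f k y) n) x (psum d n).
Proof.
  induction n as [|n IH]; intros H; simpl.
  - apply @is_derive_const.
  - apply @is_derive_plus; [apply IH; intros; apply H; lia | apply H; lia].
Qed.

Lemma Rabs_sin_le (x : R) : Rabs (sin x) <= Rabs x.
Proof.
  destruct (MVT_gen sin 0 x cos) as [c [_ Hc]].
  - intros y _. apply is_derive_sin.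
  - intros y _. apply continuity_pt_filterlim. apply continuous_sin.
  - rewrite sin_0, !Rminus_0_r in Hc. rewrite Hc, Rabs_mult.
    pose proof (COS_bound c). pose proof (Rabs_pos x).
    assert (Rabs (cos c) <= 1) by (apply Rabs_le; lra). nra.
Qed.

(** Sine increases on [[-PI/2, PI/2]]. Bounding by [sin (t / 2)] itself lets the denominators below
    cancel exactly, without a lower bound on the sine. *)
Lemma Rabs_sin_scaled_le (c t : R) : Rabs c <= 1 -> 0 <= t <= PI ->
  Rabs (sin (c * t / 2)) <= sin (t / 2).
Proof.
  intros Hc Ht. apply Rabs_le_between in Hc.
  apply Rabs_le. rewrite <- sin_neg.
  split; apply sin_incr_1; nra.
Qed.

(** Telescoping: [2 sin(t/2) cos((k+1/2)t) = sin((k+1)t) - sin(kt)]. *)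
Lemma dirichlet_kernel (t : R) (n : nat) :
  2 * sin (t / 2) * psum (fun k => cos ((INR k + / 2) * t)) n = sin (INR n * t).
Proof.
  induction n as [|n IH].
  - rewrite psum_0. simpl. rewrite Rmult_0_l, sin_0; ring.
  - rewrite psum_S, Rmult_plus_distr_l, IH, S_INR.
    replace (INR n * t) with ((INR n + / 2) * t - t / 2) by field.
    replace ((INR n + 1) * t) with ((INR n + / 2) * t + t / 2) by field.
    rewrite sin_minus, sin_plus. ring.
Qed.

Section CosecantExpansion.

Variables (b : R) (N : nat).
Hypotheses (Hb : 0 < b < 1) (HN : (0 < N)%nat).

(** The frequencies [n + b] and [n + 1 - b] lie symmetrically about [n + 1/2], at distance [|c|]. *)
Let c := / 2 - b.

(* At [t = PI] this is, up to the factor [sin (b PI)], the partial sum of the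
   cosecant series minus the case [b = 1/2], which is Leibniz's series. Its
   derivative is [quot t * sin (N t)] with [quot] and [quot'] bounded, so one
   integration by parts gains a factor [1/N]. *)
Let sine_diff (t : R) : R := psum (fun n =>
  sin ((INR n + b) * t) / (INR n + b)
  + sin ((INR n + 1 - b) * t) / (INR n + 1 - b)
  - 2 * (sin ((INR n + / 2) * t) / (INR n + / 2))) N.

Let quot (t : R) : R := (cos (c * t) - 1) / sin (t / 2).

Let quot' (t : R) : R :=
  (- c * sin (c * t) * sin (t / 2) - (cos (c * t) - 1) * (cos (t / 2) / 2))
  / sin (t / 2) ^ 2.

(** The symmetric cosines combine to [2 cos((n+1/2)t) cos(ct)]. Subtracting the case [b = 1/2] turns
    [cos(ct)] into [cos(ct) - 1], of second order at [0], which outweighs the [1/sin(t/2)] of the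
    Dirichlet kernel. *)
Lemma is_derive_sine_diff (t : R) : 0 < sin (t / 2) ->
  is_derive sine_diff t (quot t * sin (INR N * t)).
Proof.
  intros Hs.
  replace (quot t * sin (INR N * t)) with (psum (fun n =>
    cos ((INR n + b) * t) + cos ((INR n + 1 - b) * t)
      - 2 * cos ((INR n + / 2) * t)) N).
  - apply is_derive_psum. intros n _. pose proof (pos_INR n).
    auto_derive; [easy|]. field. lra.
  - rewrite <- dirichlet_kernel. unfold quot.
    transitivity (2 * (cos (c * t) - 1) * psum (fun k => cos ((INR k + / 2) * t)) N);
      [|field; lra].
    rewrite <- psum_scal. apply psum_ext; intros n _.
    replace ((INR n + b) * t) with ((INR n + / 2) * t - c * t) by (unfold c; field).
    replace ((INR n + 1 - b) * t) with ((INR n + / 2) * t + c * t) by (unfold c; field).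
    rewrite cos_minus, cos_plus. ring.
Qed.

Lemma Rabs_cos_sub_1_le (t : R) : 0 <= t <= PI ->
  Rabs (cos (c * t) - 1) <= 2 * sin (t / 2) ^ 2.
Proof.
  intros Ht.
  replace (c * t) with (2 * (c * t / 2)) by field. rewrite cos_2a_sin.
  replace (1 - 2 * sin (c * t / 2) * sin (c * t / 2) - 1) with
    (- (2 * (sin (c * t / 2) * sin (c * t / 2)))) by ring.
  assert (Hs := Rabs_sin_scaled_le c t).
  assert (Hc : Rabs c <= 1) by (unfold c; apply Rabs_le; lra).
  specialize (Hs Hc Ht).
  rewrite Rabs_Ropp, !Rabs_mult, (Rabs_right 2) by lra.
  pose proof (Rabs_pos (sin (c * t / 2))). nra.
Qed.

Lemma Rabs_quot_le (t : R) : 0 < t <= PI -> Rabs (quot t) <= 2.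
Proof.
  intros Ht. assert (Hs : 0 < sin (t / 2)) by (apply sin_gt_0; lra).
  pose proof (SIN_bound (t / 2)).
  unfold quot. rewrite Rabs_div, (Rabs_right (sin (t / 2))) by lra.
  apply Rle_div_l; [lra|].
  eapply Rle_trans; [apply Rabs_cos_sub_1_le; lra | nra].
Qed.

(** Both terms of the numerator are at most [sin(t/2)^2]: the first because [|c| <= 1/2] and
    [|sin(ct)| <= 2 sin(t/2)], the second by the bound on [cos(ct) - 1]. *)
Lemma Rabs_quot'_le (t : R) : 0 < t <= PI -> Rabs (quot' t) <= 2.
Proof.
  intros Ht. assert (Hs : 0 < sin (t / 2)) by (apply sin_gt_0; lra).
  assert (Hs2 : 0 < sin (t / 2) ^ 2) by (apply pow_lt; lra).
  unfold quot'. rewrite Rabs_div, (Rabs_right (sin (t / 2) ^ 2)) by lra.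
  apply Rle_div_l; [lra|].
  assert (Hc : Rabs c <= / 2) by (unfold c; apply Rabs_le; lra).
  assert (H1 : Rabs (sin (c * t)) <= 2 * sin (t / 2)).
  { replace (c * t) with (2 * (c * t / 2)) by field. rewrite sin_2a.
    rewrite !Rabs_mult, (Rabs_right 2) by lra.
    assert (Hs' := Rabs_sin_scaled_le c t ltac:(lra) ltac:(lra)).
    pose proof (COS_bound (c * t / 2)).
    assert (Rabs (cos (c * t / 2)) <= 1) by (apply Rabs_le; lra).
    pose proof (Rabs_pos (cos (c * t / 2))).
    pose proof (Rabs_pos (sin (c * t / 2))). nra. }
  eapply Rle_trans; [apply Rabs_triang|]. rewrite Rabs_Ropp, !Rabs_mult, Rabs_Ropp.
  rewrite Rabs_div, (Rabs_right (sin (t / 2))), (Rabs_right 2) by lra.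
  pose proof (COS_bound (t / 2)).
  assert (Rabs (cos (t / 2)) <= 1) by (apply Rabs_le; lra).
  pose proof (Rabs_pos (cos (t / 2))).
  pose proof (Rabs_cos_sub_1_le t ltac:(lra)).
  pose proof (Rabs_pos c). pose proof (Rabs_pos (sin (c * t))).
  pose proof (Rabs_pos (cos (c * t) - 1)).
  assert (Rabs c * Rabs (sin (c * t)) <= sin (t / 2)) by nra.
  assert (Rabs (cos (c * t) - 1) * (Rabs (cos (t / 2)) / 2) <= sin (t / 2) ^ 2) by nra.
  nra.
Qed.

(** The formula for [quot] degenerates at [t = 0], so the mean value theorem is applied on [[e, PI]]
    and [sine_diff e] is estimated directly by [|sin(ae)/a| <= e]. *)
Lemma Rabs_sine_diff_PI_le_eps (e : R) : 0 < e < PI ->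
  Rabs (sine_diff PI) <= 4 * INR N * e + 14 / INR N.
Proof.
  intros He. assert (HN0 : 0 < INR N) by (apply lt_0_INR; easy).
  assert (Hpi := PI_4).
  (* Integration by parts in differential form: the added term cancels [quot t * sin (N t)] in the
     derivative, leaving [dF] of size [2/N]. With [PI <= 4] the increment of [F] is at most [8/N],
     and the two endpoint terms add [2/N] each; 14 leaves some slack. *)
  set (F := fun t => sine_diff t + quot t * (cos (INR N * t) / INR N)).
  set (dF := fun t => quot' t * (cos (INR N * t) / INR N)).
  assert (HF : forall t, 0 < t <= PI -> is_derive F t (dF t)).
  { intros t Ht. assert (Hs : 0 < sin (t / 2)) by (apply sin_gt_0; lra).
    replace (dF t) with (quot t * sin (INR N * t)
       + (quot' t * (cos (INR N * t) / INR N) + quot t * - sin (INR N * t))) by (unfold dF; ring).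
    apply (is_derive_plus sine_diff); [apply is_derive_sine_diff; easy|].
    unfold quot, quot'. auto_derive; [lra|]. change (t * / 2) with (t / 2). field. lra. }
  assert (Hcos : forall t, Rabs (cos (INR N * t) / INR N) <= / INR N).
  { intros t. unfold Rdiv. rewrite Rabs_mult, (Rabs_right (/ _)).
    2:{ left; apply Rinv_0_lt_compat; easy. }
    rewrite <- (Rmult_1_l (/ INR N)) at 2. apply Rmult_le_compat_r.
    - left; apply Rinv_0_lt_compat; easy.
    - apply Rabs_le. pose proof (COS_bound (INR N * t)). lra. }
  assert (HI : 0 < / INR N) by (apply Rinv_0_lt_compat; easy).
  assert (Hwc : forall t, 0 < t <= PI ->
     Rabs (quot t * (cos (INR N * t) / INR N)) <= 2 * / INR N).
  { intros t Ht. rewrite Rabs_mult. apply Rmult_le_compat; try apply Rabs_pos.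
    - apply Rabs_quot_le; easy.
    - apply Hcos. }
  assert (HJe : Rabs (sine_diff e) <= 4 * INR N * e).
  { unfold sine_diff. eapply Rle_trans; [apply psum_Rabs with (g := fun _ => 4 * e)|].
    - intros n _. pose proof (pos_INR n).
      assert (Hq : forall a, 0 < a -> Rabs (sin (a * e) / a) <= e).
      { intros a Ha. unfold Rdiv. rewrite Rabs_mult, (Rabs_right (/ a)).
        2:{ left; apply Rinv_0_lt_compat; easy. }
        apply (Rmult_le_reg_r a); [easy|]. rewrite Rmult_assoc, Rinv_l, Rmult_1_r by lra.
        eapply Rle_trans; [apply Rabs_sin_le|]. rewrite Rabs_right by nra. lra. }
      unfold Rminus at 1.
      eapply Rle_trans; [apply Rabs_triang|]. rewrite Rabs_Ropp.
      eapply Rle_trans; [apply Rplus_le_compat_r, Rabs_triang|].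
      rewrite (Rabs_mult 2), (Rabs_right 2) by lra.
      pose proof (Hq (INR n + b) ltac:(lra)). pose proof (Hq (INR n + 1 - b) ltac:(lra)).
      pose proof (Hq (INR n + / 2) ltac:(lra)). lra.
    - right. clear. induction N as [|n IH]; [rewrite psum_0; simpl; ring|].
      rewrite psum_S, IH, S_INR. ring. }
  destruct (MVT_gen F e PI dF) as [x [Hx E]].
  - intros t Ht. rewrite Rmin_left, Rmax_right in Ht by lra. apply HF; lra.
  - intros t Ht. rewrite Rmin_left, Rmax_right in Ht by lra.
    apply continuity_pt_filterlim.
    apply (ex_derive_continuous F). exists (dF t). apply HF; lra.
  - rewrite Rmin_left, Rmax_right in Hx by lra.
    assert (HdF : Rabs (dF x * (PI - e)) <= 8 * / INR N).
    { unfold dF. rewrite !Rabs_mult.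
      pose proof (Rabs_quot'_le x ltac:(lra)). pose proof (Hcos x).
      rewrite (Rabs_right (PI - e)) by lra.
      pose proof (Rabs_pos (quot' x)). pose proof (Rabs_pos (cos (INR N * x) / INR N)).
      apply Rle_trans with (2 * / INR N * 4); [|lra].
      apply Rmult_le_compat; try lra; [nra|]. apply Rmult_le_compat; lra. }
    replace (sine_diff PI) with (sine_diff e + quot e * (cos (INR N * e) / INR N)
      + - (quot PI * (cos (INR N * PI) / INR N)) + dF x * (PI - e)).
    + eapply Rle_trans; [apply Rabs_triang|].
      eapply Rle_trans; [apply Rplus_le_compat_r, Rabs_triang|].
      eapply Rle_trans; [apply Rplus_le_compat_r, Rplus_le_compat_r, Rabs_triang|].
      rewrite Rabs_Ropp.
      pose proof (Hwc e ltac:(lra)). pose proof (Hwc PI ltac:(lra)). unfold Rdiv at 3. lra.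
    + rewrite <- E. unfold F. ring.
Qed.

Lemma sin_mult_PI (n : nat) (x : R) : sin (INR n * PI + x) = (-1) ^ n * sin x.
Proof.
  induction n as [|n IH]; [simpl; rewrite Rmult_0_l, Rplus_0_l; ring|].
  rewrite S_INR. replace ((INR n + 1) * PI + x) with ((INR n * PI + x) + PI) by ring.
  rewrite neg_sin, IH. simpl. ring.
Qed.

(** Here [N] stays fixed while [e] tends to [0], so the term [4 * INR N * e] disappears despite its
    factor [N]. *)
Lemma cosecant_partial_sum_le :
  Rabs (sin (b * PI) * psum (fun n => (-1) ^ n * (/ (INR n + b) + / (INR n + 1 - b))) N
        - 2 * psum (fun n => (-1) ^ n / (INR n + / 2)) N) <= 14 / INR N.
Proof.
  assert (HN0 : 0 < INR N) by (apply lt_0_INR; easy).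
  assert (HP := PI_RGT_0).
  replace (_ - _) with (sine_diff PI).
  - apply le_epsilon. intros e He.
    set (e' := Rmin (e / (4 * INR N)) (PI / 2)).
    assert (He' : 0 < e' <= e / (4 * INR N) /\ e' <= PI / 2).
    { unfold e'. split; [split; [|apply Rmin_l]|apply Rmin_r].
      apply Rmin_glb_lt; [|lra]. apply Rdiv_lt_0_compat; lra. }
    eapply Rle_trans; [apply (Rabs_sine_diff_PI_le_eps e'); lra|].
    rewrite Rplus_comm. apply Rplus_le_compat_l.
    replace e with (4 * INR N * (e / (4 * INR N))) by (field; lra).
    apply Rmult_le_compat_l; lra.
  - unfold sine_diff. rewrite <- !psum_scal, <- psum_minus. apply psum_ext; intros n _.
    replace ((INR n + b) * PI) with (INR n * PI + b * PI) by ring.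
    replace ((INR n + 1 - b) * PI) with (INR n * PI + (PI - b * PI)) by ring.
    replace ((INR n + / 2) * PI) with (INR n * PI + PI / 2) by field.
    rewrite !sin_mult_PI, sin_PI2, <- sin_PI_x.
    replace (PI - (PI - b * PI)) with (b * PI) by ring.
    rewrite <- sin_PI_x. replace (PI - (PI - b * PI)) with (b * PI) by ring.
    unfold Rdiv. ring.
Qed.

End CosecantExpansion.

Lemma is_lim_seq_leibniz :
  is_lim_seq (fun N => 2 * psum (fun n => (-1) ^ n / (INR n + / 2)) N) PI.
Proof.
  rewrite <- Alt_PI_eq. unfold Alt_PI. destruct exist_PI as [a Ha].
  apply is_lim_seq_Reals, (is_lim_seq_scal_l _ 4) in Ha. simpl in Ha.
  apply is_lim_seq_incr_1. eapply is_lim_seq_ext; [|exact Ha].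
  intros n. cbv beta. rewrite <- psum_scal.
  change (4 * sum_f_R0 (tg_alt PI_tg) n =
    psum (fun k => 2 * ((-1) ^ k / (INR k + / 2))) (S n)).
  assert (Ht : forall k, 4 * tg_alt PI_tg k = 2 * ((-1) ^ k / (INR k + / 2))).
  { intros k. unfold tg_alt, PI_tg. rewrite plus_INR, mult_INR. simpl (INR 2).
    simpl (INR 1). pose proof (pos_INR k). field. lra. }
  induction n as [|n IH].
  - rewrite psum_S, psum_0, <- Ht. simpl sum_f_R0. ring.
  - rewrite psum_S, <- IH, <- Ht, tech5. ring.
Qed.

Lemma is_lim_seq_cosecant (b : R) : 0 < b < 1 ->
  is_lim_seq (psum (fun n => (-1) ^ n * (/ (INR n + b) + / (INR n + 1 - b))))
    (PI / sin (PI * b)).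
Proof.
  intros Hb. assert (HL := is_lim_seq_leibniz). assert (HP := PI_RGT_0).
  assert (Hs : 0 < sin (b * PI)) by (apply sin_gt_0; nra).
  set (P := psum _).
  assert (H0 : is_lim_seq (fun N => sin (b * PI) * P N
     - 2 * psum (fun n => (-1) ^ n / (INR n + / 2)) N) 0).
  { apply is_lim_seq_abs_0.
    apply is_lim_seq_le_le_loc with (u := fun _ => 0) (w := fun N => 14 * / INR N).
    - exists 1%nat. intros N HN. split; [apply Rabs_pos|].
      apply cosecant_partial_sum_le; [easy | lia].
    - apply is_lim_seq_const.
    - replace 0 with (14 * 0) by ring. apply (is_lim_seq_scal_l _ _ 0).
      apply (is_lim_seq_inv _ p_infty); [apply is_lim_seq_INR | easy]. }
  assert (H1 := is_lim_seq_plus' _ _ _ _ H0 HL).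
  apply (is_lim_seq_scal_l _ (/ sin (b * PI))) in H1. simpl in H1.
  replace (PI / sin (PI * b)) with (/ sin (b * PI) * (0 + PI)).
  - eapply is_lim_seq_ext; [|exact H1]. intros N. simpl. field. lra.
  - rewrite (Rmult_comm PI b). field. lra.
Qed.

(** * The Gamma integral *)

Lemma ln_le_sub_1 (x : R) : 0 < x -> ln x <= x - 1.
Proof.
  intros Hx. pose proof (exp_ineq1_le (ln x)). rewrite exp_ln in H by easy. lra.
Qed.

Lemma exp_le_compat (x y : R) : x <= y -> exp x <= exp y.
Proof. intros [H| ->]; [left; apply exp_increasing; easy | apply Rle_refl]. Qed.

Lemma filter_prod_0_infty (a0 b0 : R) (P : R * R -> Prop) :
  0 < a0 -> (forall a b, 0 < a < a0 -> b0 < b -> P (a, b)) ->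
  filter_prod (at_right 0) (Rbar_locally p_infty) P.
Proof.
  intros Ha H. apply (Filter_prod _ _ _ (fun a => 0 < a < a0) (fun b => b0 < b)).
  - exists (mkposreal a0 Ha). intros y Hy Hy0. split; [easy|].
    change (Rabs (y - 0) < a0) in Hy. apply Rabs_lt_between in Hy. lra.
  - exists b0. easy.
  - intros a b Hab Hb. apply H; easy.
Qed.

(** Monotone convergence: the improper integral is the supremum of the integrals over compact
    intervals. The second conclusion later gives [Gamma] a positive lower bound. *)
Lemma is_RInt_gen_nonneg_bounded (f : R -> R) (M : R) :
  (forall t, 0 < t -> 0 <= f t) -> (forall t, 0 < t -> continuous f t) ->
  (forall a b, 0 < a <= b -> RInt f a b <= M) ->
  exists l, is_RInt_gen f (at_right 0) (Rbar_locally p_infty) l /\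
    forall a b, 0 < a <= b -> RInt f a b <= l.
Proof.
  intros Hf Hc HM.
  assert (Hex : forall a b, 0 < a <= b -> ex_RInt f a b).
  { intros a b Hab. apply @ex_RInt_continuous. intros z Hz.
    rewrite Rmin_left in Hz by lra. apply Hc; lra. }
  destruct (completeness (fun y => exists a b, 0 < a <= b /\ y = RInt f a b))
    as [l [Hl1 Hl2]].
  - exists M. intros y [a [b [Hab ->]]]. apply HM; easy.
  - exists (RInt f 1 2), 1, 2. split; [lra|easy].
  - exists l.
    assert (Hl : forall a b, 0 < a <= b -> RInt f a b <= l).
    { intros a b Hab. apply Hl1. exists a, b. easy. }
    split; [|easy].
    apply (filterlimi_lim_ext_loc (fun ab => RInt f (fst ab) (snd ab))).
    + apply (filter_prod_0_infty 1 1); [lra|]. intros a b Ha Hb.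
      apply (@RInt_correct R_CompleteNormedModule), Hex. simpl. lra.
    + apply filterlim_locally. intros eps.
      (* An interval nearly attaining the supremum; by nonnegativity every larger interval does at
         least as well. *)
      destruct (classic (exists a b, 0 < a <= b /\ l - eps < RInt f a b))
        as [[a0 [b0 [Hab Hlt]]]|Hn].
      * apply (filter_prod_0_infty a0 b0); [lra|]. intros a b Ha Hb. simpl.
        change (Rabs (RInt f a b - l) < eps).
        assert (RInt f a b = RInt f a a0 + RInt f a0 b0 + RInt f b0 b).
        { rewrite <- (RInt_Chasles f a b0 b), <- (RInt_Chasles f a a0 b0);
            try (apply Hex; lra). easy. }
        assert (0 <= RInt f a a0).
        { apply RInt_ge_0; [lra | apply Hex; lra | intros; apply Hf; lra]. }
        assert (0 <= RInt f b0 b).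
        { apply RInt_ge_0; [lra | apply Hex; lra | intros; apply Hf; lra]. }
        pose proof (Hl a b ltac:(lra)).
        apply Rabs_def1; pose proof (cond_pos eps); lra.
      * exfalso. assert (l <= l - eps).
        { apply Hl2. intros y [a [b [Hab ->]]]. apply Rnot_lt_le. intros Hlt.
          apply Hn. exists a, b. split; easy. }
        pose proof (cond_pos eps). lra.
Qed.

Definition gamma_integrand (x t : R) : R := Rpower t (x - 1) * exp (- t).

Lemma gamma_integrand_pos (x t : R) : 0 < gamma_integrand x t.
Proof. apply Rmult_lt_0_compat; apply exp_pos. Qed.

Lemma gamma_integrand_continuous (x t : R) :
  0 < t -> continuous (gamma_integrand x) t.
Proof.
  intros Ht. apply (ex_derive_continuous (gamma_integrand x)).
  unfold gamma_integrand, Rpower. auto_derive. easy.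
Qed.

Lemma gamma_integrand_S (x t : R) : 0 < t ->
  gamma_integrand (x + 1) t = t * gamma_integrand x t.
Proof.
  intros Ht. unfold gamma_integrand.
  replace (x + 1 - 1) with (1 + (x - 1)) by ring.
  rewrite Rpower_plus, Rpower_1 by easy. ring.
Qed.

(** The maximum over [t] is at [1 + t = s]; the bound is [ln u <= u - 1] at [u = (1+t)/s]. It says
    that [(1+t)^s exp(-t)] is bounded. *)
Lemma power_exp_bounded (s : R) : 0 < s ->
  forall t, 0 < t -> s * ln (1 + t) - t <= 1 - s + s * ln s.
Proof.
  intros Hs t Ht. pose proof (ln_le_sub_1 ((1 + t) / s)) as H.
  unfold Rdiv in H. rewrite ln_mult, ln_Rinv in H; try lra.
  2:{ apply Rinv_0_lt_compat; lra. }
  assert (0 < (1 + t) * / s) by (apply Rmult_lt_0_compat; [lra | apply Rinv_0_lt_compat; lra]).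
  specialize (H H0). apply (Rmult_le_compat_l s) in H; [|lra].
  replace (s * ((1 + t) * / s - 1)) with (1 + t - s) in H by (field; lra). lra.
Qed.

(* The integrand is dominated by a multiple of [t^(x-1) / (1+t)^(x+1)], the
   derivative of [(t / (1+t))^x / x]. *)
Lemma gamma_integral_bounded (x : R) : 0 < x ->
  exists M, forall a b, 0 < a <= b -> RInt (gamma_integrand x) a b <= M.
Proof.
  intros Hx. set (C := exp (1 - (x + 1) + (x + 1) * ln (x + 1))).
  set (A := fun t => C * (exp (x * (ln t - ln (1 + t))) / x)).
  set (dA := fun t => C * (exp (x * (ln t - ln (1 + t))) * (/ t - / (1 + t)))).
  exists (C / x). intros a b Hab.
  assert (HC : 0 < C) by apply exp_pos.
  assert (HdA : is_RInt dA a b (A b - A a)).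
  { apply (is_RInt_derive A).
    - intros t Ht. rewrite Rmin_left in Ht by lra. unfold A, dA.
      auto_derive; [lra|]. unfold Rminus. field. lra.
    - intros t Ht. rewrite Rmin_left in Ht by lra.
      apply (ex_derive_continuous dA). unfold dA. auto_derive. lra. }
  apply Rle_trans with (A b - A a).
  - rewrite <- (is_RInt_unique _ _ _ _ HdA). apply RInt_le.
    + lra.
    + apply @ex_RInt_continuous. intros z Hz. rewrite Rmin_left in Hz by lra.
      apply gamma_integrand_continuous; lra.
    + exists (A b - A a). exact HdA.
    + intros t Ht. unfold gamma_integrand, dA, Rpower, C.
      replace (/ t - / (1 + t)) with (exp (- ln t) * exp (- ln (1 + t))).
      * rewrite <- !exp_plus. apply exp_le_compat.
        pose proof (power_exp_bounded (x + 1) ltac:(lra) t ltac:(lra)). lra.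
      * rewrite !exp_Ropp, !exp_ln by lra. field. lra.
  - assert (Ha : 0 < A a).
    { apply Rmult_lt_0_compat; [easy|]. apply Rdiv_lt_0_compat; [apply exp_pos|easy]. }
    assert (Hb : A b <= C / x).
    { unfold A, Rdiv. apply Rmult_le_compat_l; [lra|].
      rewrite <- (Rmult_1_l (/ x)) at 2. apply Rmult_le_compat_r.
      - left; apply Rinv_0_lt_compat; easy.
      - apply Rle_trans with (exp 0); [|rewrite exp_0; lra]. apply exp_le_compat.
        assert (ln b <= ln (1 + b)) by (apply ln_le; lra).
        assert (0 <= x * (ln (1 + b) - ln b)) by (apply Rmult_le_pos; lra). lra. }
    lra.
Qed.

Lemma is_RInt_gen_Gamma_unique (x l : R) :
  is_RInt_gen (gamma_integrand x) (at_right 0) (Rbar_locally p_infty) l ->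
  Gamma x = l.
Proof. intros H. exact (is_RInt_gen_unique (V := R_CompleteNormedModule)
    (Fa := at_right 0) (Fb := Rbar_locally p_infty) (gamma_integrand x) l H). Qed.

Lemma is_RInt_gen_Gamma (x : R) : 0 < x ->
  is_RInt_gen (gamma_integrand x) (at_right 0) (Rbar_locally p_infty) (Gamma x).
Proof.
  intros Hx. destruct (gamma_integral_bounded x Hx) as [M HM].
  destruct (is_RInt_gen_nonneg_bounded (gamma_integrand x) M) as [l [Hl _]].
  - intros; left; apply gamma_integrand_pos.
  - apply gamma_integrand_continuous.
  - easy.
  - rewrite (is_RInt_gen_Gamma_unique x l Hl). exact Hl.
Qed.

Lemma Gamma_pos (x : R) : 0 < x -> 0 < Gamma x.
Proof.
  intros Hx. destruct (gamma_integral_bounded x Hx) as [M HM].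
  destruct (is_RInt_gen_nonneg_bounded (gamma_integrand x) M) as [l [Hl Hle]].
  - intros; left; apply gamma_integrand_pos.
  - apply gamma_integrand_continuous.
  - easy.
  - rewrite (is_RInt_gen_Gamma_unique x l Hl).
    apply Rlt_le_trans with (RInt (gamma_integrand x) 1 2).
    + apply RInt_gt_0; [lra | intros; apply gamma_integrand_pos |].
      intros t Ht. apply gamma_integrand_continuous. lra.
    + apply Hle. lra.
Qed.

(** Integration by parts: [h] is the derivative of [F t = t^x exp(-t)], which vanishes at both
    ends. *)
Lemma Gamma_S (x : R) : 0 < x -> Gamma (x + 1) = x * Gamma x.
Proof.
  intros Hx. set (F := gamma_integrand (x + 1)).
  set (C := exp (1 - (x + 1) + (x + 1) * ln (x + 1))).
  assert (HC : 0 < C) by apply exp_pos.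
  set (h := fun t => x * gamma_integrand x t - gamma_integrand (x + 1) t).
  assert (H0 : is_RInt_gen h (at_right 0) (Rbar_locally p_infty) 0).
  { apply (filterlimi_lim_ext_loc (fun ab => F (snd ab) - F (fst ab))).
    - apply (filter_prod_0_infty 1 1); [lra|]. intros a b Ha Hb. simpl.
      apply (is_RInt_derive F).
      + intros t Ht. rewrite Rmin_left in Ht by lra.
        unfold h. rewrite gamma_integrand_S by lra.
        unfold F, gamma_integrand, Rpower.
        auto_derive; [lra|].
        replace (exp ((x + 1 - 1) * ln t)) with (t * exp ((x - 1) * ln t)).
        * field. lra.
        * replace ((x + 1 - 1) * ln t) with (ln t + (x - 1) * ln t) by ring.
          rewrite exp_plus, exp_ln by lra. easy.
      + intros t Ht. rewrite Rmin_left in Ht by lra.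
        apply (ex_derive_continuous h).
        unfold h, gamma_integrand, Rpower. auto_derive. lra.
    - apply filterlim_locally. intros eps. pose proof (cond_pos eps) as He.
      (* The first threshold is [eps^(1/x)], forcing [a^x < eps]; the second comes from
         [F b <= C / (1 + b)]. *)
      apply (filter_prod_0_infty (exp (ln eps / x)) (C / eps)); [apply exp_pos|].
      intros a b Ha Hb. simpl.
      assert (0 < C / eps) by (apply Rdiv_lt_0_compat; easy).
      change (Rabs (F b - F a - 0) < eps). rewrite Rminus_0_r.
      assert (Ha0 : 0 < F a) by apply gamma_integrand_pos.
      assert (Hb0 : 0 < F b) by apply gamma_integrand_pos.
      assert (F a < eps).
      { unfold F, gamma_integrand, Rpower. rewrite <- exp_plus.
        rewrite <- (exp_ln eps He) at 1. apply exp_increasing.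
        assert (ln a < ln eps / x).
        { rewrite <- (ln_exp (ln eps / x)). apply ln_increasing; lra. }
        assert (ln a * x < ln eps) by (apply Rlt_div_r; easy). lra. }
      assert (F b < eps).
      { apply Rle_lt_trans with (C / (1 + b)).
        - unfold F, gamma_integrand, Rpower, C, Rdiv.
          rewrite <- (exp_ln (1 + b)) at 1 by lra.
          rewrite <- exp_Ropp, <- !exp_plus. apply exp_le_compat.
          pose proof (power_exp_bounded (x + 1) ltac:(lra) b ltac:(lra)).
          assert (ln b <= ln (1 + b)) by (apply ln_le; lra).
          assert (x * ln b <= x * ln (1 + b)) by (apply Rmult_le_compat_l; lra).
          replace (x + 1 - 1) with x by ring. lra.
        - assert (0 < b) by lra. apply Rlt_div_l in Hb; [|easy]. apply Rlt_div_l; [lra|]. lra. }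
      apply Rabs_def1; lra. }
  assert (H1 := is_RInt_gen_minus _ _ _ _
    (is_RInt_gen_scal _ x _ (is_RInt_gen_Gamma x Hx)) H0).
  apply is_RInt_gen_Gamma_unique.
  replace (x * Gamma x) with (minus (scal x (Gamma x)) 0)
    by (unfold minus, plus, opp, scal; simpl; unfold mult; simpl; ring).
  eapply is_RInt_gen_ext; [|exact H1].
  apply (filter_prod_0_infty 1 1); [lra|]. intros a b _ _ t _.
  unfold h, minus, plus, opp, scal; simpl; unfold mult; simpl. ring.
Qed.

(** Weighted AM-GM for [u] and [1] with mean [m]: apply [ln v <= v - 1] at [u/m] and [1/m]. In the
    weighted sum the right sides cancel by the choice of [m]. *)
Lemma Rpower_le_affine (u l : R) : 0 < u -> 0 <= l <= 1 ->
  Rpower u l <= 1 - l + l * u.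
Proof.
  intros Hu Hl. set (m := 1 - l + l * u).
  assert (Hm : 0 < m).
  { unfold m. destruct (Req_dec l 0) as [->|]; [lra|].
    assert (0 < l * u) by (apply Rmult_lt_0_compat; lra). lra. }
  rewrite <- (exp_ln m Hm). apply exp_le_compat.
  assert (Hi : 0 < / m) by (apply Rinv_0_lt_compat; easy).
  assert (H1 : ln u - ln m <= u * / m - 1).
  { pose proof (ln_le_sub_1 (u * / m) ltac:(apply Rmult_lt_0_compat; easy)) as H.
    rewrite ln_mult, ln_Rinv in H by easy. lra. }
  assert (H2 : - ln m <= / m - 1).
  { pose proof (ln_le_sub_1 (/ m) Hi) as H. rewrite ln_Rinv in H by easy. lra. }
  apply (Rmult_le_compat_l l) in H1; [|lra].
  apply (Rmult_le_compat_l (1 - l)) in H2; [|lra].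
  assert (l * (u * / m - 1) + (1 - l) * (/ m - 1) = 0).
  { transitivity (m * / m - 1); [unfold m; ring | field; lra]. }
  lra.
Qed.

(* Integrate the weighted AM-GM inequality [(t/z)^l <= 1 - l + l (t/z)] against
   the integrand of [Gamma z]; the linear term contributes [Gamma (z+1) / z = Gamma z]. *)
Lemma Gamma_add_le (z l : R) : 0 < z -> 0 <= l <= 1 ->
  Gamma (z + l) <= Rpower z l * Gamma z.
Proof.
  intros Hz Hl.
  assert (HG : is_RInt_gen (fun t =>
      plus (scal (Rpower z l * (1 - l)) (gamma_integrand z t))
           (scal (Rpower z l * (l / z)) (gamma_integrand (z + 1) t)))
    (at_right 0) (Rbar_locally p_infty)
    (plus (scal (Rpower z l * (1 - l)) (Gamma z))
       (scal (Rpower z l * (l / z)) (Gamma (z + 1))))).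
  { apply @is_RInt_gen_plus; try apply _.
    - apply @is_RInt_gen_scal; try apply _. apply is_RInt_gen_Gamma; easy.
    - apply @is_RInt_gen_scal; try apply _. apply is_RInt_gen_Gamma; lra. }
  eapply Rle_trans; [apply Rle_abs|].
  replace (Rpower z l * Gamma z) with
    (plus (scal (Rpower z l * (1 - l)) (Gamma z))
       (scal (Rpower z l * (l / z)) (Gamma (z + 1)))).
  - refine (RInt_gen_norm (V := R_CompleteNormedModule) (Fa := at_right 0)
      (Fb := Rbar_locally p_infty) _ _ _ _ _ _
      (is_RInt_gen_Gamma (z + l) ltac:(lra)) HG).
    + apply (filter_prod_0_infty 1 1); [lra|]. intros a b Ha Hb. simpl. lra.
    + apply (filter_prod_0_infty 1 1); [lra|]. intros a b Ha Hb t Ht. simpl in Ht.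
      assert (H0 : 0 < t) by lra.
      change (norm (gamma_integrand (z + l) t)) with (Rabs (gamma_integrand (z + l) t)).
      rewrite Rabs_right by (pose proof (gamma_integrand_pos (z + l) t); lra).
      unfold plus, scal; simpl; unfold mult; simpl.
      rewrite gamma_integrand_S by lra.
      assert (E : gamma_integrand (z + l) t = Rpower t l * gamma_integrand z t).
      { unfold gamma_integrand. replace (z + l - 1) with (l + (z - 1)) by ring.
        rewrite Rpower_plus. ring. }
      assert (Ht' : Rpower t l <= Rpower z l * (1 - l + l * (t / z))).
      { replace t with (z * (t / z)) at 1 by (field; lra).
        rewrite <- Rpower_mult_distr by (try apply Rdiv_lt_0_compat; lra).
        apply Rmult_le_compat_l; [left; apply exp_pos|].
        apply Rpower_le_affine; [apply Rdiv_lt_0_compat|]; lra. }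
      rewrite E. pose proof (gamma_integrand_pos z t).
      apply (Rmult_le_compat_r (gamma_integrand z t)) in Ht'; [|lra].
      eapply Rle_trans; [exact Ht'|]. right. field. lra.
  - rewrite Gamma_S by easy. unfold plus, scal; simpl; unfold mult; simpl. field. lra.
Qed.

(** * Digamma and trigamma as limits *)

(** The quadratic bound, uniform in [n], passes to the limit. This replaces uniform convergence of
    derivatives: [l] need only converge at the single point [x]. *)
Lemma is_derive_limit_quadratic (f : nat -> R -> R) (l : nat -> R) (F : R -> R)
  (x L C r : R) : 0 < r -> 0 <= C ->
  (forall y, Rabs (y - x) <= r -> is_lim_seq (fun n => f n y) (F y)) ->
  is_lim_seq l L ->
  (forall n y, Rabs (y - x) <= r ->
     Rabs (f n y - f n x - (y - x) * l n) <= C * (y - x) ^ 2) ->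
  is_derive F x L.
Proof.
  intros Hr HC HF HL Hq.
  assert (HQ : forall y, Rabs (y - x) <= r ->
     Rabs (F y - F x - (y - x) * L) <= C * (y - x) ^ 2).
  { intros y Hy.
    refine (is_lim_seq_le _ _ (Rabs (F y - F x - (y - x) * L)) (C * (y - x) ^ 2)
      (fun n => Hq n y Hy) _ (is_lim_seq_const _)).
    apply (is_lim_seq_abs _ (F y - F x - (y - x) * L)).
    apply is_lim_seq_minus'; [apply is_lim_seq_minus'|].
    - apply HF; easy.
    - apply HF. rewrite Rminus_diag, Rabs_R0. lra.
    - apply (is_lim_seq_scal_l _ _ L). easy. }
  apply is_derive_Reals. intros eps He.
  (* [C + 1] guards against [C = 0]. *)
  assert (Hd : 0 < Rmin r (eps / (C + 1))).
  { apply Rmin_glb_lt; [easy | apply Rdiv_lt_0_compat; lra]. }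
  exists (mkposreal _ Hd). intros h Hh Hlt. simpl in Hlt.
  assert (Rabs h < r) by (eapply Rlt_le_trans; [apply Hlt | apply Rmin_l]).
  assert (Rabs h < eps / (C + 1)) by (eapply Rlt_le_trans; [apply Hlt | apply Rmin_r]).
  specialize (HQ (x + h)). replace (x + h - x) with h in HQ by ring.
  specialize (HQ ltac:(lra)).
  replace ((F (x + h) - F x) / h - L) with ((F (x + h) - F x - h * L) / h) by (field; easy).
  pose proof (Rabs_pos_lt h Hh).
  rewrite Rabs_div by easy. apply Rlt_div_l; [easy|].
  eapply Rle_lt_trans; [exact HQ|].
  replace (h ^ 2) with (Rabs h * Rabs h) by (rewrite <- Rabs_mult, Rabs_right; nra).
  apply Rlt_div_r in H0; [|lra]. nra.
Qed.

Lemma psum_inv_sqr_le (x : R) (n : nat) : 0 < x ->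
  psum (fun k => / (INR k + x) ^ 2) n <= / x ^ 2 + / x.
Proof.
  intros Hx. destruct n as [|n].
  - rewrite psum_0. pose proof (Rinv_0_lt_compat x Hx).
    pose proof (Rinv_0_lt_compat (x ^ 2) ltac:(nra)). lra.
  (* Strengthened by the telescoping tail [/ (INR n + x)] so that the induction closes. *)
  - enough (psum (fun k => / (INR k + x) ^ 2) (S n) <= / x ^ 2 + / x - / (INR n + x)).
    { pose proof (pos_INR n). pose proof (Rinv_0_lt_compat (INR n + x) ltac:(lra)). lra. }
    induction n as [|n IH].
    + rewrite psum_S, psum_0. simpl INR. rewrite !Rplus_0_l. lra.
    + rewrite psum_S, S_INR. pose proof (pos_INR n).
      assert (/ (INR n + 1 + x) ^ 2 <= / (INR n + x) - / (INR n + 1 + x)).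
      { replace (/ (INR n + x) - / (INR n + 1 + x)) with
          (/ ((INR n + x) * (INR n + 1 + x))) by (field; lra).
        apply Rinv_le_contravar; nra. }
      lra.
Qed.

Lemma is_lim_seq_inv_INR : is_lim_seq (fun n => / INR n) 0.
Proof. apply (is_lim_seq_inv _ p_infty); [apply is_lim_seq_INR | easy]. Qed.

Lemma ln_add_sub_bounds (a h : R) : 0 < a -> 0 < a + h ->
  h / (a + h) <= ln (a + h) - ln a <= h / a.
Proof.
  intros Ha Hh. split.
  - pose proof (ln_le_sub_1 (a / (a + h)) ltac:(apply Rdiv_lt_0_compat; easy)) as H.
    rewrite ln_div in H by easy.
    replace (a / (a + h) - 1) with (- (h / (a + h))) in H by (field; lra). lra.
  - pose proof (ln_le_sub_1 ((a + h) / a) ltac:(apply Rdiv_lt_0_compat; easy)) as H.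
    rewrite ln_div in H by easy.
    replace ((a + h) / a - 1) with (h / a) in H by (field; lra). lra.
Qed.

Lemma is_lim_seq_ln_shift (x : R) : 0 < x ->
  is_lim_seq (fun n => ln (INR n + x) - ln (INR n)) 0.
Proof.
  intros Hx.
  apply is_lim_seq_le_le_loc with (u := fun _ => 0) (w := fun n => x * / INR n).
  - exists 1%nat. intros n Hn. assert (0 < INR n) by (apply lt_0_INR; lia).
    destruct (ln_add_sub_bounds (INR n) x ltac:(lra) ltac:(lra)) as [H1 H2].
    split; [|exact H2]. eapply Rle_trans; [|exact H1].
    apply Rdiv_le_0_compat; lra.
  - apply is_lim_seq_const.
  - replace 0 with (x * 0) by ring. apply (is_lim_seq_scal_l _ _ 0), is_lim_seq_inv_INR.
Qed.

(** With [ln (n + x)] in place of [ln n] the sequence is decreasing and bounded below by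
    telescoping; the change tends to [0]. Existence comes first, so that the limit can then be
    identified as a derivative. *)
Lemma ex_lim_ln_sub_psum (x : R) : 0 < x ->
  ex_finite_lim_seq (fun n => ln (INR n) - psum (fun k => / (INR k + x)) n).
Proof.
  intros Hx.
  destruct (ex_finite_lim_seq_decr
    (fun n => ln (INR n + x) - psum (fun k => / (INR k + x)) n) (ln x - / x)) as [l Hl].
  - intros n. rewrite psum_S, S_INR. pose proof (pos_INR n).
    pose proof (ln_add_sub_bounds (INR n + x) 1 ltac:(lra) ltac:(lra)).
    replace (INR n + x + 1) with (INR n + 1 + x) in H0 by ring. unfold Rdiv in H0. lra.
  - intros [|n].
    + rewrite psum_0. simpl INR. rewrite Rplus_0_l.
      pose proof (Rinv_0_lt_compat x Hx). lra.
    + assert (psum (fun k => / (INR k + x)) (S n) <= ln (INR n + x) - ln x + / x).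
      { induction n as [|n IH].
        - rewrite psum_S, psum_0. simpl INR. rewrite !Rplus_0_l. lra.
        - rewrite psum_S. pose proof (pos_INR n).
          pose proof (ln_add_sub_bounds (INR n + x) 1 ltac:(lra) ltac:(lra)).
          replace (INR n + x + 1) with (INR (S n) + x) in H0 by (rewrite S_INR; ring).
          unfold Rdiv in H0. lra. }
      assert (ln (INR n + x) <= ln (INR (S n) + x)).
      { pose proof (pos_INR n). apply ln_le; rewrite ?S_INR; lra. }
      lra.
  - exists l. apply is_lim_seq_ext with
      (fun n => ln (INR n + x) - psum (fun k => / (INR k + x)) n
                - (ln (INR n + x) - ln (INR n))).
    + intros n. ring.
    + replace l with (l - 0) by ring.
      apply is_lim_seq_minus'; [easy | apply is_lim_seq_ln_shift; easy].
Qed.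

Lemma ln_Gamma_S (x : R) : 0 < x -> ln (Gamma (x + 1)) = ln x + ln (Gamma x).
Proof. intros Hx. rewrite Gamma_S by easy. apply ln_mult; [easy | apply Gamma_pos; easy]. Qed.

Lemma ln_Gamma_add_le (z l : R) : 0 < z -> 0 <= l <= 1 ->
  ln (Gamma (z + l)) <= l * ln z + ln (Gamma z).
Proof.
  intros Hz Hl. pose proof (Gamma_pos z Hz).
  replace (l * ln z) with (ln (Rpower z l)) by apply ln_exp.
  rewrite <- ln_mult by (easy || apply exp_pos).
  apply ln_le; [apply Gamma_pos; lra | apply Gamma_add_le; easy].
Qed.

(** For [x <= 1] a squeeze; [m] only counts unit steps, taken by the functional equation, that reach
    larger [x]. *)
Lemma is_lim_seq_ln_Gamma_ratio (x : R) (m : nat) : 0 <= x <= INR m ->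
  is_lim_seq (fun n => ln (Gamma (INR n + x)) - ln (Gamma (INR n)) - x * ln (INR n)) 0.
Proof.
  revert x. induction m as [|m IH]; intros x Hx.
  - simpl in Hx. replace x with 0 by lra.
    apply is_lim_seq_ext with (fun _ => 0); [|apply is_lim_seq_const].
    intros n. rewrite Rplus_0_r. ring.
  - rewrite S_INR in Hx. destruct (Rle_dec x 1) as [H1|H1].
    + apply is_lim_seq_le_le_loc with
        (u := fun n => - (ln (INR n + 1) - ln (INR n))) (w := fun _ => 0).
      * exists 1%nat. intros n Hn. assert (Hn0 : 0 < INR n) by (apply lt_0_INR; lia).
        pose proof (ln_Gamma_add_le (INR n) x Hn0 ltac:(lra)).
        (* The lower bound: the same inequality, started at [n + x] and ending at [n + 1]. *)
        pose proof (ln_Gamma_add_le (INR n + x) (1 - x) ltac:(lra) ltac:(lra)).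
        replace (INR n + x + (1 - x)) with (INR n + 1) in H0 by ring.
        rewrite ln_Gamma_S in H0 by easy.
        assert (ln (INR n) <= ln (INR n + x) <= ln (INR n + 1)).
        { split; apply ln_le; lra. }
        split; nra.
      * replace (Finite 0) with (Rbar_opp 0) by (simpl; f_equal; ring).
        apply -> is_lim_seq_opp. apply is_lim_seq_ln_shift; lra.
      * apply is_lim_seq_const.
    + assert (Hx' : 0 <= x - 1 <= INR m) by lra.
      pose proof (is_lim_seq_plus' _ _ _ _ (IH _ Hx')
        (is_lim_seq_ln_shift (x - 1) ltac:(lra))) as H.
      rewrite Rplus_0_r in H.
      eapply is_lim_seq_ext_loc; [|exact H].
      exists 1%nat. intros n Hn. assert (Hn0 : 0 < INR n) by (apply lt_0_INR; lia).
      replace (INR n + x) with (INR n + (x - 1) + 1) by ring.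
      rewrite ln_Gamma_S by lra. ring.
Qed.

Lemma ln_Gamma_add_nat (x : R) (n : nat) : 0 < x ->
  ln (Gamma (INR n + x)) = ln (Gamma x) + psum (fun k => ln (INR k + x)) n.
Proof.
  intros Hx. induction n as [|n IH].
  - rewrite psum_0. simpl. rewrite Rplus_0_l. ring.
  - rewrite psum_S, S_INR. pose proof (pos_INR n).
    replace (INR n + 1 + x) with (INR n + x + 1) by ring.
    rewrite ln_Gamma_S by lra. rewrite IH. ring.
Qed.

Lemma is_lim_seq_ln_Gamma (x : R) : 0 < x ->
  is_lim_seq (fun n => ln (Gamma (INR n)) + x * ln (INR n)
                       - psum (fun k => ln (INR k + x)) n) (ln (Gamma x)).
Proof.
  intros Hx. destruct (nfloor_ex x) as [m Hm]; [lra|].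
  pose proof (is_lim_seq_ln_Gamma_ratio x (S m) ltac:(rewrite S_INR; lra)) as H.
  apply (is_lim_seq_minus' _ _ _ _ (is_lim_seq_const (ln (Gamma x)))) in H.
  rewrite Rminus_0_r in H.
  eapply is_lim_seq_ext; [|exact H].
  intros n. cbv beta. rewrite ln_Gamma_add_nat by easy. ring.
Qed.

(** The upper and lower bounds on the increment of [ln] differ by [h^2 / (a (a + h))], and
    [a + h >= a / 2]. *)
Lemma ln_quadratic (a h : R) : 0 < a -> Rabs h <= a / 2 ->
  Rabs (ln (a + h) - ln a - h / a) <= 2 * h ^ 2 * / a ^ 2.
Proof.
  intros Ha Hh. apply Rabs_le_between in Hh.
  destruct (ln_add_sub_bounds a h ltac:(lra) ltac:(lra)) as [H1 H2].
  assert (h / a - h / (a + h) <= 2 * h ^ 2 * / a ^ 2).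
  { replace (h / a - h / (a + h)) with (h ^ 2 * / (a * (a + h))) by (field; lra).
    replace (2 * h ^ 2 * / a ^ 2) with (h ^ 2 * / (a * (a / 2))) by (field; lra).
    apply Rmult_le_compat_l; [nra|]. apply Rinv_le_contravar; nra. }
  assert (0 <= 2 * h ^ 2 * / a ^ 2).
  { apply Rmult_le_pos; [nra|]. left. apply Rinv_0_lt_compat. nra. }
  apply Rabs_le. lra.
Qed.

Lemma is_derive_ln_Gamma (x L : R) : 0 < x ->
  is_lim_seq (fun n => ln (INR n) - psum (fun k => / (INR k + x)) n) L ->
  is_derive (fun y => ln (Gamma y)) x L.
Proof.
  intros Hx HL.
  assert (HK : 0 <= 2 * (/ x ^ 2 + / x)).
  { pose proof (psum_inv_sqr_le x 0 Hx). rewrite psum_0 in H. lra. }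
  (* The radius [x / 2] suits every [k] at once because [x <= k + x]; the remainders sum to a
     multiple of [psum_inv_sqr_le]. *)
  apply (is_derive_limit_quadratic
    (fun n y => ln (Gamma (INR n)) + y * ln (INR n) - psum (fun k => ln (INR k + y)) n)
    (fun n => ln (INR n) - psum (fun k => / (INR k + x)) n)
    _ x L (2 * (/ x ^ 2 + / x)) (x / 2)); [lra | easy | | exact HL |].
  - intros y Hy. apply Rabs_le_between in Hy. apply is_lim_seq_ln_Gamma. lra.
  - intros n y Hy. set (h := y - x) in *.
    replace (_ - _ - _) with (- psum (fun k =>
        ln (INR k + x + h) - ln (INR k + x) - h / (INR k + x)) n).
    + rewrite Rabs_Ropp.
      eapply Rle_trans; [apply psum_Rabs with
        (g := fun k => 2 * h ^ 2 * / (INR k + x) ^ 2)|].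
      * intros k _. pose proof (pos_INR k). apply ln_quadratic; lra.
      * rewrite psum_scal.
        replace (2 * (/ x ^ 2 + / x) * h ^ 2) with (2 * h ^ 2 * (/ x ^ 2 + / x)) by ring.
        apply Rmult_le_compat_l; [nra|]. apply psum_inv_sqr_le; easy.
    + unfold Rdiv. rewrite !psum_minus, psum_scal.
      rewrite (psum_ext (fun k => ln (INR k + x + h)) (fun k => ln (INR k + y))).
      * unfold h. ring.
      * intros k _. f_equal. unfold h. ring.
Qed.

(** [Derive] is total, so differentiability of [Gamma] must be shown: it is recovered as
    [exp (ln (Gamma y))] near [x], where [Gamma] is positive. *)
Lemma is_lim_seq_digamma (x : R) : 0 < x ->
  is_lim_seq (fun n => ln (INR n) - psum (fun k => / (INR k + x)) n) (digamma x).
Proof.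
  intros Hx. destruct (ex_lim_ln_sub_psum x Hx) as [L HL].
  replace (digamma x) with L; [easy|].
  pose proof (Gamma_pos x Hx) as Hg.
  assert (HD : is_derive Gamma x (L * Gamma x)).
  { apply is_derive_ext_loc with (fun y => exp (ln (Gamma y))).
    - exists (mkposreal x Hx). intros y Hy. change (Rabs (y - x) < x) in Hy.
      apply Rabs_lt_between in Hy. apply exp_ln, Gamma_pos. lra.
    - rewrite <- (exp_ln (Gamma x)) by easy.
      apply (is_derive_comp exp (fun y => ln (Gamma y))).
      + apply is_derive_exp.
      + apply is_derive_ln_Gamma; easy. }
  unfold digamma. rewrite (is_derive_unique _ _ _ HD). field. lra.
Qed.

(** The remainder of each term is exactly [-(y-x)^2 / ((k+y)(k+x)^2)], and [k + y >= x / 2] yields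
    the constant [2 / x]. *)
Lemma is_lim_seq_trigamma (x : R) : 0 < x ->
  is_lim_seq (psum (fun k => / (INR k + x) ^ 2)) (trigamma x).
Proof.
  intros Hx.
  destruct (ex_finite_lim_seq_incr (psum (fun k => / (INR k + x) ^ 2)) (/ x ^ 2 + / x))
    as [L HL].
  - intros n. rewrite psum_S. pose proof (pos_INR n).
    assert (0 < / (INR n + x) ^ 2) by (apply Rinv_0_lt_compat, pow_lt; lra). lra.
  - intros n. apply psum_inv_sqr_le; easy.
  - replace (trigamma x) with L; [easy|]. symmetry. apply is_derive_unique.
    assert (HK : 0 <= / x ^ 2 + / x).
    { pose proof (psum_inv_sqr_le x 0 Hx). rewrite psum_0 in H. lra. }
    assert (Hx2 : 0 < 2 / x) by (apply Rdiv_lt_0_compat; lra).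
    apply (is_derive_limit_quadratic
      (fun n y => ln (INR n) - psum (fun k => / (INR k + y)) n)
      (psum (fun k => / (INR k + x) ^ 2)) _ x L (2 / x * (/ x ^ 2 + / x)) (x / 2));
      [lra | nra | | exact HL |].
    + intros y Hy. apply Rabs_le_between in Hy. apply is_lim_seq_digamma. lra.
    + intros n y Hy. apply Rabs_le_between in Hy.
      replace (_ - _ - _) with (- ((y - x) ^ 2 *
        psum (fun k => / (INR k + y) * / (INR k + x) ^ 2) n)).
      * rewrite Rabs_Ropp, Rabs_mult, (Rabs_right ((y - x) ^ 2)) by apply Rle_ge, pow2_ge_0.
        rewrite (Rmult_comm _ ((y - x) ^ 2)).
        apply Rmult_le_compat_l; [apply pow2_ge_0|].
        eapply Rle_trans; [apply psum_Rabs with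
          (g := fun k => 2 / x * / (INR k + x) ^ 2)|].
        -- intros k _. pose proof (pos_INR k).
           assert (0 < / (INR k + x) ^ 2) by (apply Rinv_0_lt_compat, pow_lt; lra).
           assert (0 < / (INR k + y)) by (apply Rinv_0_lt_compat; lra).
           rewrite Rabs_mult, !Rabs_right by lra.
           apply Rmult_le_compat_r; [lra|].
           replace (2 / x) with (/ (x / 2)) by (field; lra).
           apply Rinv_le_contravar; lra.
        -- rewrite psum_scal. apply Rmult_le_compat_l; [lra|].
           apply psum_inv_sqr_le; easy.
      * replace (_ - _ - _) with
          (psum (fun k => / (INR k + x)) n - psum (fun k => / (INR k + y)) n
           - (y - x) * psum (fun k => / (INR k + x) ^ 2) n) by ring.
        rewrite <- !psum_scal, <- !psum_minus.
        replace (- psum _ n) with (-1 * psum (fun k =>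
          (y - x) ^ 2 * (/ (INR k + y) * / (INR k + x) ^ 2)) n) by ring.
        rewrite <- psum_scal.
        apply psum_ext; intros k _. pose proof (pos_INR k). field. lra.
Qed.

(** * The limits needed, and the evaluation of the series *)

(** [harmonic n] is the same sum at [b = 1], so the two [ln n] cancel. *)
Lemma is_lim_seq_psum_inv_sub_harmonic (b : R) : 0 < b ->
  is_lim_seq (fun n => psum (fun k => / (INR k + b)) n - harmonic n)
    (digamma 1 - digamma b).
Proof.
  intros Hb.
  apply (is_lim_seq_ext _ _ _) with (2 := is_lim_seq_minus' _ _ _ _
    (is_lim_seq_digamma 1 ltac:(lra)) (is_lim_seq_digamma b Hb)).
  intros n. rewrite harmonic_psum.
  rewrite (psum_ext (fun k => / INR (S k)) (fun k => / (INR k + 1))); [ring|].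
  intros k _. rewrite S_INR. easy.
Qed.

(** Even and odd indices give [1/(2k+b)^2 = (1/4)/(k+b/2)^2] and [(1/4)/(k+(b+1)/2)^2]. Odd partial
    sums differ from even ones by a vanishing term. *)
Lemma is_lim_seq_alternating_trigamma (b : R) : 0 < b ->
  is_lim_seq (psum (fun n => (-1) ^ n / (INR n + b) ^ 2))
    (/ 4 * (trigamma (b / 2) - trigamma ((b + 1) / 2))).
Proof.
  intros Hb.
  set (Q := psum _). set (l := / 4 * _).
  assert (HE : is_lim_seq (fun n => Q (2 * n)%nat) l).
  { apply (is_lim_seq_ext (fun n => / 4 * (psum (fun k => / (INR k + b / 2) ^ 2) n
       - psum (fun k => / (INR k + (b + 1) / 2) ^ 2) n))).
    - induction n as [|n IH]; [unfold Q; simpl; ring|].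
      replace (2 * S n)%nat with (S (S (2 * n))) by lia.
      unfold Q in *. rewrite (psum_S _ (S (2 * n))), (psum_S _ (2 * n)), <- IH, !psum_S.
      rewrite <- (tech_pow_Rmult (-1)), pow_1_even, S_INR, mult_INR. simpl (INR 2).
      pose proof (pos_INR n). field. lra.
    - apply (is_lim_seq_scal_l _ _ (_ - _)).
      apply is_lim_seq_minus'; apply is_lim_seq_trigamma; lra. }
  assert (HO : is_lim_seq (fun n => Q (2 * n + 1)%nat) l).
  { apply (is_lim_seq_ext (fun n => Q (2 * n)%nat + / (INR (2 * n) + b) ^ 2)).
    - intros n. rewrite Nat.add_1_r. unfold Q. rewrite psum_S, pow_1_even.
      unfold Rdiv; ring.
    - replace l with (l + 0) by ring. apply is_lim_seq_plus'; [easy|].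
      apply is_lim_seq_le_le_loc with (u := fun _ => 0) (w := fun n => / INR n).
      + exists 1%nat. intros n Hn. assert (1 <= INR n) by (apply (le_INR 1); lia).
        rewrite mult_INR. simpl (INR 2). split.
        * left. apply Rinv_0_lt_compat, pow_lt. lra.
        * apply Rinv_le_contravar; nra.
      + apply is_lim_seq_const.
      + apply is_lim_seq_inv_INR. }
  apply is_lim_seq_spec in HE. apply is_lim_seq_spec in HO.
  apply is_lim_seq_spec. intros eps.
  destruct (HE eps) as [N1 H1]. destruct (HO eps) as [N2 H2].
  exists (2 * (N1 + N2) + 1)%nat. intros n Hn.
  destruct (Nat.Even_or_Odd n) as [[k ->]|[k ->]]; [apply H1 | apply H2]; lia.
Qed.

Theorem theorem3p4 (q : R) (hq : 1 < q) :
  is_series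
    (fun k : nat =>
       let n := S k in
       (-1) ^ (n + 1) * harmonic n *
         (1 / (q * INR n + q - 1) + 1 / (q * INR n + 1)))
    (1 / (4 * q) *
       (trigamma ((2 * q - 1) / (2 * q)) - trigamma ((q - 1) / (2 * q)))
     - PI / (q * sin (PI / q)) * (digamma (1 - 1 / q) - digamma 1)).
Proof.
  set (b := 1 - 1 / q).
  assert (Hq : 0 < 1 / q < 1).
  { split; [apply Rdiv_lt_0_compat; lra | apply Rlt_div_l; lra]. }
  assert (Hb : 0 < b < 1) by (unfold b; lra).
  replace ((2 * q - 1) / (2 * q)) with ((b + 1) / 2) by (unfold b; field; lra).
  replace ((q - 1) / (2 * q)) with (b / 2) by (unfold b; field; lra).
  replace (sin (PI / q)) with (sin (PI * b)).
  2:{ rewrite <- sin_PI_x. f_equal. unfold b. field. lra. }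
  assert (Hs : 0 < sin (PI * b)) by (pose proof PI_RGT_0; apply sin_gt_0; nra).
  apply is_series_psum.
  set (P := psum (fun n => (-1) ^ n * (/ (INR n + b) + / (INR n + 1 - b)))).
  set (U := psum (fun k => / (INR k + b))).
  set (Q := psum (fun n => (-1) ^ n / (INR n + b) ^ 2)).
  assert (HL := is_lim_seq_scal_l _ (/ q) _ (is_lim_seq_minus' _ _ _ _
    (is_lim_seq_minus' _ _ _ _
      (is_lim_seq_mult' _ _ _ _ (is_lim_seq_cosecant b Hb)
        (is_lim_seq_psum_inv_sub_harmonic b ltac:(lra)))
      (is_lim_seq_alternating_trigamma b ltac:(lra)))
    (is_lim_seq_pf_remainder b Hb))).
  fold P U Q in HL.
  (* [N] terms of the series run over [n = 1..N], matching the product identity at [S N], which also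
     has [n = 0]. *)
  apply is_lim_seq_incr_1 in HL.
  match goal with |- is_lim_seq _ (Finite ?l) =>
    match type of HL with is_lim_seq _ ?l' => replace (Finite l) with l' end end.
  - eapply is_lim_seq_ext; [|exact HL]. intros N. cbv beta.
    assert (E := psum_product b (S N) Hb). fold P U Q in E.
    (* The term [n = 0] enters only [harmonic (S N) * P (S N)], since [harmonic 0 = 0]; the sign
       [(-1)^(n+1)] absorbs the minus before [harmonic n]. *)
    assert (E' : psum (fun n => (-1) ^ n * (/ (INR n + b) + / (INR n + 1 - b))
        * (harmonic (S N) - harmonic n)) (S N) =
        harmonic (S N) * P (S N) + q * psum (fun k =>
          (-1) ^ (S k + 1) * harmonic (S k) *
         (1 / (q * INR (S k) + q - 1) + 1 / (q * INR (S k) + 1))) N).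
    { unfold P. rewrite <- psum_scal, !psum_shift, <- psum_scal, Rplus_assoc, <- psum_plus.
      rewrite harmonic_0. f_equal; [ring|]. apply psum_ext; intros k _.
      rewrite Nat.add_1_r, <- (tech_pow_Rmult _ (S k)).
      pose proof (lt_0_INR (S k) ltac:(lia)). unfold b. field.
      repeat split; nra. }
    rewrite E' in E.
    apply (Rmult_eq_reg_l q); [|lra]. rewrite <- Rmult_assoc, Rinv_r, Rmult_1_l by lra.
    lra.
  - simpl. f_equal. field. lra.
Qed.
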